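(* Let $n \ge 1$, $s \in (0,1)$, and let $K \subset \mathbb{R}^n$ be an unconditional strictly convex body. Then every minimizer $M \subset \mathbb{R}^n$ of the anisotropic fractional isoperimetric inequality $$P_s(E,K) \ge \gamma_{n,s}(K)\,|E|^{\frac{n-s}{n}}, \qquad E \subset \mathbb{R}^n \text{ bounded Borel},$$ is, up to translation, equivalent to an unconditional star body.
   Context: $|E|$ denotes $n$-dimensional Lebesgue measure. A convex body is a compact convex subset of $\mathbb{R}^n$ with non-empty interior. A subset of $\mathbb{R}^n$ is unconditional if it is symmetric with respect to every coordinate hyperplane $\{x_i=0\}$, $i=1,\dots,n$. A convex body $K$ is strictly convex if $(1-\lambda)x+\lambda y \in \operatorname{int} K$ for all $x,y\in K$ with $x\ne y$ and all $0<\lambda<1$. For an origin-symmetric convex body $K$, $\|\cdot\|_K$ is the norm on $\mathbb{R}^n$ with closed unit ball $K$. For a Borel set $E \subseteq \mathbb{R}^n$ with complement $E^c$, the anisotropic fractional $s$-perimeter is $$P_s(E,K) := \int_E \int_{E^c} \frac{1}{\|x-y\|_K^{n+s}}\,dy\,dx .$$ The optimal constant is $\gamma_{n,s}(K) := \inf\{P_s(E,K)|E|^{-\frac{n-s}{n}} : E\subset\mathbb{R}^n \text{ bounded Borel}, |E|>0\}$, and a minimizer is a bounded Borel set with positive measure attaining this infimum. Two sets are equivalent if they differ by a set of measure $0$. A set $L\subseteq\mathbb{R}^n$ is star-shaped (with respect to the origin $o$) if for every $x\in L$ the segment $[o,x]$ lies in $L$. The radial function of a bounded star-shaped set $L$ is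 $\rho_L(x) := \sup\{\lambda\ge 0 : \lambda x\in L\}$, $x\in\mathbb{R}^n\setminus\{o\}$. A star body is a bounded star-shaped set that contains the origin in its interior and whose radial function is continuous. *)

(* Defs.v *)
From HB Require Import structures.
From mathcomp Require Import all_boot all_order all_algebra.
From mathcomp Require Import all_classical all_reals all_analysis.
From mathcomp Require Import measurable_realfun.

Set Implicit Arguments.
Unset Strict Implicit.
Unset Printing Implicit Defensive.

Import Order.TTheory GRing.Theory Num.Theory.
Import numFieldNormedType.Exports.

Local Open Scope classical_set_scope.
Local Open Scope ring_scope.

HB.instance Definition _ (R : realType) (n : nat) :=
  @isMeasurable.Build (sigma_display (@open 'rV[R]_n)) 'rV[R]_n
    <<s @open 'rV[R]_n >> (@sigma_algebra0 _ setT (@open 'rV[R]_n))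
    (@sigma_algebraC _ (@open 'rV[R]_n))
    (@sigma_algebra_bigcup _ setT (@open 'rV[R]_n)).

Lemma measurable_rVE (R : realType) (n : nat) :
  (measurable : set (set 'rV[R]_n)) = <<s open >>.
Proof. by []. Qed.

Definition rV_cons (R : realType) (n : nat) (a : R) (v : 'rV[R]_n) :
    'rV[R]_n.+1 :=
  \row_i (if unlift ord0 i is Some j then v ord0 j else a).

(* n-dimensional Lebesgue measure, as the n-fold product of the Lebesgue
   measure of R: the recursive clause is lebesgue_measure \x lebesgue_rV n
   transported along (a, v) |-> rV_cons a v. *)
Fixpoint lebesgue_rV (R : realType) (n : nat) : set 'rV[R]_n -> \bar R :=
  match n with
  | 0 => fun A => \d_(0 : 'rV[R]_0) A
  | n.+1 => fun A =>
      (\int[@lebesgue_measure R]_a lebesgue_rV [set v | A (rV_cons a v)])%E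
  end.

Section lebesgue_rV_measure.
Variable R : realType.

Lemma measurable_coord n (j : 'I_n) :
  measurable_fun setT (fun v : 'rV[R]_n => v ord0 j).
Proof.
apply: (measurability _ (RGenOpens.measurableE R)).
move=> _ [_ [a [b ->] <-]]; rewrite setTI; apply: sub_sigma_algebra.
have /continuousP := @coord_continuous R 1 n ord0 j; apply.
exact/interval_open.
Qed.

Let box n (c : 'rV[rat]_n) k : set 'rV[R]_n :=
  [set y | forall i, `|y ord0 i - ratr (c ord0 i)| < k.+1%:R^-1].

Let open_bigcup_box n (U : set 'rV[R]_n) : open U ->
  U = \bigcup_(p : 'rV[rat]_n * nat)
        (if `[< box p.1 p.2 `<=` U >] then box p.1 p.2 else set0).
Proof.
move=> oU; apply/seteqP; split=> [x Ux|x [p _]]; last first.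
  by case: asboolP => // + bx; apply.
have : nbhs x U by rewrite nbhsE /=; exists U.
move=> /nbhs_ballP[e /= e0 eU].
have [k ke] : exists k, k.+1%:R^-1 < e / 2.
  have e20 : 0 < e / 2 by rewrite divr_gt0.
  have [N _ /(_ N (leqnn N)) h] := near_infty_natSinv_lt (PosNum e20).
  by exists N.
have k0 : (0 : R) < k.+1%:R^-1 by rewrite invr_gt0.
have rq i : exists q : rat, `|x ord0 i - ratr q| < k.+1%:R^-1.
  have /rat_in_itvoo[q qx] : x ord0 i - k.+1%:R^-1 < x ord0 i + k.+1%:R^-1.
    by rewrite ltrBlDr -addrA ltrDl addr_gt0.
  by exists q; rewrite distrC ltr_distl; move: qx; rewrite in_itv.
have [q qx] := choice rq.
pose c : 'rV[rat]_n := \row_i q i.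
have cx : box c k x by move=> i; rewrite mxE.
exists (c, k) => //=; case: asboolP => // -[] y cy; apply: eU.
split => // i j; rewrite ord1 /ball /= -(subrKA (ratr (c ord0 j))).
rewrite (le_lt_trans (ler_normD _ _))// (splitr e) ltrD//.
  exact: lt_trans (cx j) ke.
by rewrite distrC; exact: lt_trans (cy j) ke.
Qed.

Lemma measurable_fun_rV d (T : measurableType d) n (f : T -> 'rV[R]_n) :
  (forall i, measurable_fun setT (fun x => f x ord0 i)) ->
  measurable_fun setT f.
Proof.
move=> mf; apply: (measurability _ (measurable_rVE R n)) => _ [U oU <-].
rewrite setTI (open_bigcup_box oU) preimage_bigcup.
apply: countable_bigcupT_measurable; first exact: countableP.
move=> [c k] /=; case: asboolP => _; last by rewrite preimage_set0.
rewrite (_ : _ @^-1` _ = \bigcap_(i : 'I_n)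
  ((fun x => f x ord0 i) @^-1` ball (ratr (c ord0 i) : R) k.+1%:R^-1)).
  apply: fin_bigcap_measurable => [|i _]; first exact: finite_finset.
  by rewrite -[X in measurable X]setTI; apply: mf => //; exact: measurable_ball.
apply/seteqP; split=> [x /= h i _|x h i]; rewrite /ball/=.
  by rewrite distrC; exact: h.
by rewrite distrC; exact: h.
Qed.

Lemma measurable_rV_cons n :
  measurable_fun setT (fun p : measurableTypeR R * 'rV[R]_n =>
    rV_cons p.1 p.2 : 'rV[R]_n.+1).
Proof.
apply: measurable_fun_rV => i; case: (unliftP ord0 i) => [j ->|->].
  under eq_fun do rewrite mxE liftK.
  by apply: (measurableT_comp (measurable_coord j)).
by under eq_fun do rewrite mxE unlift_none; exact: measurable_fst.
Qed.

Let unrV_cons n (v : 'rV[R]_n.+1) : measurableTypeR R * 'rV[R]_n :=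
  (v ord0 ord0, \row_j v ord0 (lift ord0 j)).

Let measurable_unrV_cons n : measurable_fun setT (@unrV_cons n).
Proof.
apply: measurable_fun_pair; first exact: measurable_coord.
apply: measurable_fun_rV => i; under eq_fun do rewrite mxE.
exact: measurable_coord.
Qed.

Let rV_consK n (p : measurableTypeR R * 'rV[R]_n) :
  unrV_cons (rV_cons p.1 p.2) = p.
Proof.
case: p => a v; rewrite /unrV_cons mxE unlift_none; congr pair.
by apply/rowP => j; rewrite !mxE liftK.
Qed.

Let lebesgue_rVS n (m : {sigma_finite_measure set 'rV[R]_n -> \bar R}) :
  @lebesgue_rV R n = m ->
  @lebesgue_rV R n.+1 = pushforward (@lebesgue_measure R \x m)%E
    (fun p : measurableTypeR R * 'rV[R]_n => rV_cons p.1 p.2 : 'rV[R]_n.+1).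
Proof.
move=> mE; apply/funext => A; rewrite /pushforward /product_measure1 /=.
apply: eq_integral => a _; rewrite mE /=; congr (m _).
by apply/seteqP; split => v; rewrite /xsection /= inE.
Qed.

Definition lebesgue_rV_step n (m : set 'rV[R]_n -> \bar R) :
    set 'rV[R]_n.+1 -> \bar R :=
  pushforward (@lebesgue_measure R \x m)%E
    (fun p : measurableTypeR R * 'rV[R]_n => rV_cons p.1 p.2 : 'rV[R]_n.+1).

Section step.
Variables (n : nat) (m : {sigma_finite_measure set 'rV[R]_n -> \bar R}).

Let mu : {measure set 'rV[R]_n.+1 -> \bar R} :=
  measure_function_pushforward__canonical__measure_function_Measure
    (@lebesgue_measure R \x m)%E (@measurable_rV_cons n).

HB.instance Definition _ := isMeasure.Build _ _ _ (lebesgue_rV_step m)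
  (measure0 mu) (measure_ge0 mu) (@measure_semi_sigma_additive _ _ _ mu).

Let step_sigma_finite : sigma_finite setT (lebesgue_rV_step m).
Proof.
have /sigma_finiteP[F [FT ndF Foo]] := sigma_finiteT (@lebesgue_measure R).
have /sigma_finiteP[G [GT ndG Goo]] := sigma_finiteT m.
exists (fun k => @unrV_cons n @^-1` (F k `*` G k)).
  rewrite -preimage_bigcup (_ : \bigcup_k _ = setT) ?preimage_setT//.
  apply/seteqP; split=> // -[x y] _.
  have : setT x by []. have : setT y by [].
  rewrite FT GT => -[k _ Gy] [l _ Fx]; exists (maxn k l) => //; split => /=.
    by move: x Fx; apply/subsetPset/ndF/leq_maxr.
  by move: y Gy; apply/subsetPset/ndG/leq_maxl.
move=> k; have [mF lF] := Foo k; have [mG lG] := Goo k; split.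
  rewrite -[X in measurable X]setTI; apply: measurable_unrV_cons => //.
  exact: measurableX.
rewrite /lebesgue_rV_step /pushforward -comp_preimage (_ : _ \o _ = id).
  by rewrite preimage_id product_measure1E// lte_mul_pinfty// ge0_fin_numE.
by apply/funext => p; exact: rV_consK.
Qed.

HB.instance Definition _ := Measure_isSigmaFinite.Build _ _ _
  (lebesgue_rV_step m) step_sigma_finite.

End step.

Let lebesgue_rV_sigma_finite_measure n :
  {m : {sigma_finite_measure set 'rV[R]_n -> \bar R} | @lebesgue_rV R n = m}.
Proof.
elim: n => [|n [m mE]]; first by exists (dirac (0 : 'rV[R]_0)).
by exists (lebesgue_rV_step m); exact: lebesgue_rVS.
Qed.

Let lebesgue_rV0 n : @lebesgue_rV R n set0 = 0%E.
Proof. by have [m ->] := lebesgue_rV_sigma_finite_measure n. Qed.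

Let lebesgue_rV_ge0 n A : (0 <= @lebesgue_rV R n A)%E.
Proof. by have [m ->] := lebesgue_rV_sigma_finite_measure n. Qed.

Let lebesgue_rV_semi_sigma_additive n : semi_sigma_additive (@lebesgue_rV R n).
Proof.
have [m ->] := lebesgue_rV_sigma_finite_measure n.
exact: measure_semi_sigma_additive.
Qed.

HB.instance Definition _ n := isMeasure.Build _ _ _ (@lebesgue_rV R n)
  (@lebesgue_rV0 n) (@lebesgue_rV_ge0 n) (@lebesgue_rV_semi_sigma_additive n).

Let lebesgue_rV_sigma_finite n : sigma_finite setT (@lebesgue_rV R n).
Proof.
by have [m ->] := lebesgue_rV_sigma_finite_measure n; exact: sigma_finiteT.
Qed.

HB.instance Definition _ n := Measure_isSigmaFinite.Build _ _ _
  (@lebesgue_rV R n) (@lebesgue_rV_sigma_finite n).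

Lemma lebesgue_rV_box n (a b : 'rV[R]_n) :
  (forall i, a ord0 i <= b ord0 i) ->
  lebesgue_rV [set v : 'rV[R]_n | forall i, a ord0 i <= v ord0 i <= b ord0 i] =
  (\prod_i (b ord0 i - a ord0 i))%:E.
Proof.
elim: n => [|n ih] in a b *.
  move=> _; rewrite big_ord0 /= diracE mem_set//.
  by move=> -[].
move=> ab; rewrite (@lebesgue_rVS n (@lebesgue_rV R n))//.
pose tl (v : 'rV[R]_n.+1) : 'rV[R]_n := \row_j v ord0 (lift ord0 j).
set B := [set v : 'rV[R]_n |
  forall i, tl a ord0 i <= v ord0 i <= tl b ord0 i].
rewrite /pushforward (_ : _ @^-1` _ =
    (`[a ord0 ord0, b ord0 ord0]%classic : set (measurableTypeR R)) `*` B).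
  rewrite product_measure1E//; last first.
    rewrite (_ : B = \bigcap_(i : 'I_n)
        ((fun v : 'rV[R]_n => v ord0 i) @^-1` `[tl a ord0 i, tl b ord0 i])).
      apply: fin_bigcap_measurable => [|i _]; first exact: finite_finset.
      by rewrite -[X in measurable X]setTI; exact: measurable_coord.
    apply/seteqP; split=> [v Bv i _|v Bv i].
      by rewrite /preimage/= in_itv/=; exact: Bv.
    by have := Bv i I; rewrite /preimage/= in_itv.
  rewrite [X in (_ * X)%E](ih (tl a) (tl b)) => [|i]; last by rewrite !mxE.
  rewrite [X in (X * _)%E](lebesgue_measure_itv `[a ord0 ord0, b ord0 ord0]).
  rewrite /= lte_fin big_ord_recl EFinM.
  congr (_ * _)%E; last by congr EFin; apply: eq_bigr => i _; rewrite !mxE.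
  case: ltP => // ba; have := ab ord0.
  by rewrite le_eqVlt ltNge ba orbF => /eqP ->; rewrite subrr.
apply/seteqP; split=> -[x v] /=.
  move=> h; split; first by have := h ord0; rewrite in_itv/= mxE unlift_none.
  by move=> i; have := h (lift ord0 i); rewrite !mxE liftK.
rewrite in_itv/= => -[xab vB] i; rewrite mxE.
by case: unliftP => [j ->|->]//; have := vB j; rewrite !mxE.
Qed.

End lebesgue_rV_measure.

Section convex_geometry.
Variables (R : realType) (n : nat).
Implicit Types (x y t : 'rV[R]_n) (A E K L M : set 'rV[R]_n) (s : R).

Definition convex_body K := [/\ compact K, convex_set K & K^° !=set0].

Definition reflection (i : 'I_n) x : 'rV[R]_n :=
  \row_j (if j == i then - x ord0 j else x ord0 j).

Definition unconditional A := forall i : 'I_n, reflection i @` A = A.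

Definition strictly_convex_body K := convex_body K /\
  forall x y (l : R), K x -> K y -> x != y -> 0 < l < 1 ->
    K^° ((1 - l) *: x + l *: y).

(* Minkowski functional, i.e. the norm with closed unit ball K when K is an
   origin-symmetric convex body (see gauge_norm_le1). *)
Definition gauge_norm K x : R := inf [set r : R | 0 < r /\ K (r^-1 *: x)].

Lemma gauge_norm_le1 K x : convex_body K -> (forall y, K y -> K (- y)) ->
  gauge_norm K x <= 1 <-> K x.
Proof.
move=> [cptK cvxK [p /nbhs_ballP[e /= e0 peK]]] symK.
have convK y z (l : R) : K y -> K z -> 0 <= l <= 1 -> K (l *: y + (1 - l) *: z).
  move=> Ky Kz /andP[l0 l1].
  have := cvxK y z (Itv01 l0 l1); rewrite !inE; exact.
have Ke z : `|z| < e / 2 -> K z.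
  move=> ze.
  have -> : z = 2^-1 *: (p + 2 *: z) + (1 - 2^-1) *: - p.
    rewrite [X in (X - _) *: _](splitr 1) mul1r addrK scalerDr scalerN scalerA.
    by rewrite mulVf// scale1r addrAC subrr add0r.
  apply: convK; last by rewrite invr_ge0 ler0n invf_le1// ler1n.
    apply: peK; rewrite -ball_normE /= opprD addNKr normrN normrZ.
    by rewrite ger0_norm// mulrC -ltr_pdivlMr.
  by apply/symK/peK; exact: ballxx.
have K0 : K 0 by apply: Ke; rewrite normr0 divr_gt0.
have starK y (l : R) : K y -> 0 <= l <= 1 -> K (l *: y).
  by move=> Ky l01; have := convK _ _ _ Ky K0 l01; rewrite scaler0 addr0.
pose S := [set r : R | 0 < r /\ K (r^-1 *: x)].
have S0 : has_inf S.
  split; last by exists 0 => r [/ltW].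
  pose r := (`|x| + 1) / (e / 2).
  have x1 : 0 < `|x| + 1 by rewrite ltr_wpDl.
  have r0 : 0 < r by rewrite !divr_gt0.
  exists r; split => //; apply: Ke; rewrite normrZ gtr0_norm ?invr_gt0//.
  by rewrite mulrC ltr_pdivrMr// /r mulrC divfK ?gt_eqF ?divr_gt0// ltrDl.
split=> [g1|Kx]; last first.
  by apply: (ge_inf S0.2); rewrite /S /= invr1 scale1r.
have clK : closed K by apply: compact_closed => //; exact: norm_hausdorff.
have KS (d : R) : 0 < d -> K ((1 + d)^-1 *: x).
  move=> d0; have [r [r0 Kr] rd] := inf_adherent d0 S0.
  have r1 : r <= 1 + d by rewrite (le_trans (ltW rd))// lerD2r.
  have d1 : 0 < 1 + d by rewrite addr_gt0.
  have -> : (1 + d)^-1 *: x = (r / (1 + d)) *: (r^-1 *: x).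
    by rewrite scalerA mulrAC divff ?gt_eqF// mul1r.
  by apply: starK => //; rewrite ler_pdivrMr// mul1r r1 divr_ge0 ?ltW.
apply: (closed_cvg _ clK (F := (0 : R)^'+) (u_ := fun d : R => (1 + d)^-1 *: x)).
  by near=> d; exact: KS.
rewrite -[X in _ --> X]scale1r; apply: cvgZl.
rewrite -[X in _ --> X]invr1; apply: cvgV; first exact: oner_neq0.
rewrite -[X in _ --> X]addr0; apply: cvgD; first exact: cvg_cst.
exact: cvg_at_right_filter.
Unshelve. all: by end_near. Qed.

Definition bounded_borel E := bounded_set E /\ measurable E.

Definition frac_perimeter s E K : \bar R :=
  (\int[@lebesgue_rV R n]_(x in E) \int[@lebesgue_rV R n]_(y in ~` E)
     ((gauge_norm K (x - y) `^ (n%:R + s))^-1%R)%:E)%E.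

Definition isoperimetric_ratio s K E : \bar R :=
  (frac_perimeter s E K * lebesgue_rV E `^ (- ((n%:R - s) / n%:R)))%E.

Definition isoperimetric_constant s K : \bar R :=
  ereal_inf [set isoperimetric_ratio s K E |
             E in [set E | bounded_borel E /\ (0 < lebesgue_rV E)%E]].

Definition isoperimetric_minimizer s K M :=
  [/\ bounded_borel M, (0 < lebesgue_rV M)%E &
      isoperimetric_ratio s K M = isoperimetric_constant s K].

Definition star_shaped L := forall x (l : R), L x -> 0 <= l <= 1 -> L (l *: x).

Definition radial_function L x : R := sup [set l : R | 0 <= l /\ L (l *: x)].

Definition star_body L :=
  [/\ bounded_set L, star_shaped L, L^° 0 &
      {within [set x | x != 0], continuous (radial_function L)}].

(* A star body need not be Borel, so "measure 0" is negligibility. *)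
Definition equivalent_sets A L := (@lebesgue_rV R n).-negligible (A `+` L).

Definition translate t A := [set x + t | x in A].

End convex_geometry.

(* Main.v *)
(** Polarize a minimizer [M] with respect to a hyperplane [x_i = c], with
    reflection [sigma]: the part [B'] of [M] below the hyperplane whose mirror
    image misses [M] is replaced by its mirror image. Since [K] is
    unconditional and strictly convex, the kernel strictly decreases when
    [x - y] is replaced by [x - sigma y] for [x], [y] above the hyperplane, so
    the perimeter strictly drops unless [B'], or the analogous part of [M]
    above the hyperplane, is null. Hence for every hyperplane one half of [M]
    reflects into the other, up to null sets.

    For each coordinate choose the hyperplane bisecting [M], and translate
    these to the coordinate hyperplanes. Composing reflections then shows that
    for every [z], almost every [x] in [M] with [|x_j - z_j| < |x_j|] for all
    [j] satisfies [x - z \in M]. By Tonelli, for almost every [x] in [M] the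
    open box [|y_j| < |x_j|] lies in [M] up to a null set. The union [L] of
    all open centered boxes (of bounded size) that are almost contained in [M]
    is therefore equivalent to [M]: a countable union accounts for
    [L \ M], and no two points of [M \ L] (off a null set) dominate one another
    in all coordinates, which forces [M \ L] to be null since within an orthant
    its translates along the diagonal are disjoint. An open bounded set that
    contains with [x] all [y] with [|y_j| <= |x_j|] has a continuous radial
    function. *)

Require Import Defs.
From mathcomp Require Import all_boot all_order all_algebra.
From mathcomp Require Import all_classical all_reals all_analysis.
From mathcomp Require Import measurable_realfun.
From mathcomp Require Import ring lra.
Import Order.TTheory GRing.Theory Num.Theory.
Import numFieldNormedType.Exports.
Set Implicit Arguments.
Unset Strict Implicit.
Unset Printing Implicit Defensive.
Local Open Scope classical_set_scope.
Local Open Scope ring_scope.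

(** * Signed translations preserve Lebesgue measure *)

Section signed_translation.
Variable R : realType.

Lemma lebesgue_rVS n (A : set 'rV[R]_n.+1) : lebesgue_rV A =
  (\int[@lebesgue_measure R]_a lebesgue_rV [set v | A (rV_cons a v)])%E.
Proof. by []. Qed.

(** Half-open intervals determine Lebesgue measure, and their preimages are again half-open
    intervals of the same length. *)
Lemma lebesgue_measure_signed_translation (b : bool) (t : R) (A : set R) :
  measurable A ->
  pushforward (@lebesgue_measure R)
    (fun x => (-1) ^+ b * x + t : measurableTypeR R) A = lebesgue_measure A.
Proof.
move=> mA; apply/esym.
have mf : measurable_fun setT
    (fun x : measurableTypeR R => (-1) ^+ b * x + t : measurableTypeR R).
  by apply: measurable_funD => //; exact: mulrl_measurable.
pose mu := measure_function_pushforward__canonical__measure_function_Measure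
  (@lebesgue_measure R) mf.
apply: (@lebesgue_measure_unique R mu) => //= _ [[x y]] _ <-.
rewrite /mu/= /pushforward.
case: b {mf mu} => /=.
  rewrite expr1 (_ : _ @^-1` _ = `[t - y, t - x[%classic).
    rewrite !lebesgue_measure_itv/= !lte_fin ltrD2l ltrN2.
    by case: ifP => // _; congr EFin; ring.
  by apply/seteqP; split => z /=; rewrite !in_itv/= => /andP[]; lra.
rewrite expr0 (_ : _ @^-1` _ = `]x - t, y - t]%classic).
  rewrite !lebesgue_measure_itv/= !lte_fin ltrD2r.
  by case: ifP => // _; congr EFin; ring.
by apply/seteqP; split => z /=; rewrite !in_itv/= => /andP[]; lra.
Qed.

(* The common form of the translations and of the reflections in hyperplanes
   [x_i = c]. *)
Definition signed_translation n (b : 'I_n -> bool) (t x : 'rV[R]_n) :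
    'rV[R]_n := \row_i ((-1) ^+ b i * x ord0 i + t ord0 i).

Lemma measurable_signed_translation n (b : 'I_n -> bool) (t : 'rV[R]_n) :
  measurable_fun setT (signed_translation b t).
Proof.
apply: measurable_fun_rV => i; under eq_fun do rewrite mxE.
by apply: measurable_funD => //; apply: measurable_funM => //;
   exact: measurable_coord.
Qed.

Lemma measurable_fun_lebesgue_section n (A : set 'rV[R]_n.+1) : measurable A ->
  measurable_fun setT (fun a : measurableTypeR R =>
    lebesgue_rV [set v | A (rV_cons a v)] : \bar R).
Proof.
move=> mA.
pose B := (fun p : measurableTypeR R * 'rV[R]_n =>
    rV_cons p.1 p.2 : 'rV[R]_n.+1) @^-1` A.
have mB : measurable B.
  by rewrite -[X in measurable X]setTI; exact: measurable_rV_cons.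
have := measurable_fun_xsection (@lebesgue_rV R n) mB.
congr measurable_fun; apply/funext => a /=; congr lebesgue_rV.
by rewrite /xsection; apply/seteqP; split => v /=; rewrite inE.
Qed.

(** Induction on the dimension: the map acts separately on the first coordinate and on the others.
    The induction hypothesis removes it from each section, and a one-dimensional change of variables
    removes it from the integral over the first coordinate. *)
Lemma lebesgue_rV_signed_translation n (b : 'I_n -> bool) (t : 'rV[R]_n)
    (A : set 'rV[R]_n) : measurable A ->
  lebesgue_rV (signed_translation b t @^-1` A) = lebesgue_rV A.
Proof.
elim: n => [|n ih] in b t A *.
  move=> _; congr lebesgue_rV; apply/seteqP.
  by split => x; rewrite /preimage/= (_ : signed_translation _ _ _ = x)//;
    apply/rowP => -[].
move=> mA; rewrite !lebesgue_rVS.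
pose t' : 'rV[R]_n := \row_j t ord0 (lift ord0 j).
pose phi := fun a : measurableTypeR R =>
  (lebesgue_rV [set v | A (rV_cons a v)] : \bar R).
pose f := fun x : measurableTypeR R =>
  (-1) ^+ b ord0 * x + t ord0 ord0 : measurableTypeR R.
have mf : measurable_fun setT f.
  by apply: measurable_funD => //; exact: mulrl_measurable.
transitivity (\int[@lebesgue_measure R]_a (phi \o f) a)%E.
  apply: eq_integral => a _; rewrite /phi/=.
  have E v : signed_translation b t (rV_cons a v) =
      rV_cons (f a) (signed_translation (b \o lift ord0) t' v).
    apply/rowP => i; rewrite !mxE.
    by case: unliftP => [j ->|->]//; rewrite !mxE.
  rewrite -[RHS](ih (b \o lift ord0) t').
    by congr (lebesgue_rV _); apply/funext => v; rewrite /preimage /mkset E.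
  rewrite -[X in measurable X]setTI.
  exact: (measurable_fun_pair2 (f a) (@measurable_rV_cons R n) measurableT mA).
rewrite -[LHS](@ge0_integral_pushforward _ _ _ _ _ f mf
  (@lebesgue_measure R) setT phi)//.
- apply: eq_measure_integral => /= B mB _.
  exact: lebesgue_measure_signed_translation.
- exact: measurable_fun_lebesgue_section.
Qed.

Lemma ge0_integral_signed_translation n (b : 'I_n -> bool) (t : 'rV[R]_n)
    (A : set 'rV[R]_n) (f : 'rV[R]_n -> \bar R) :
  measurable A -> measurable_fun A f -> (forall x, A x -> 0 <= f x)%E ->
  (\int[@lebesgue_rV R n]_(x in signed_translation b t @^-1` A)
     f (signed_translation b t x) = \int[@lebesgue_rV R n]_(x in A) f x)%E.
Proof.
move=> mA mf f0.
rewrite -[LHS](@ge0_integral_pushforward _ _ _ _ _ (signed_translation b t)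
  (measurable_signed_translation b t) (@lebesgue_rV R n) A f)//.
- apply: eq_measure_integral => [|/= _ B mB _].
    exact: measurable_signed_translation.
  exact: lebesgue_rV_signed_translation.
- by move=> x; rewrite inE; exact: f0.
Qed.

Lemma measurable_signed_translation_preimage n (b : 'I_n -> bool)
    (t : 'rV[R]_n) (A : set 'rV[R]_n) : measurable A ->
  measurable (signed_translation b t @^-1` A).
Proof.
by move=> mA; rewrite -[X in measurable X]setTI;
  exact: measurable_signed_translation.
Qed.

Lemma negligible_signed_translation n (b : 'I_n -> bool) (t : 'rV[R]_n)
    (A : set 'rV[R]_n) : (@lebesgue_rV R n).-negligible A ->
  (@lebesgue_rV R n).-negligible (signed_translation b t @^-1` A).
Proof.
move=> [B [mB B0 AB]]; exists (signed_translation b t @^-1` B); split.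
- exact: measurable_signed_translation_preimage.
- exact: etrans (lebesgue_rV_signed_translation _ _ mB) B0.
- by move=> x /AB.
Qed.

Definition mirror n (i : 'I_n) (c : R) : 'rV[R]_n -> 'rV[R]_n :=
  signed_translation (fun j => j == i) (\row_j (if j == i then 2 * c else 0)).

Lemma mirrorE n (i : 'I_n) (c : R) (x : 'rV[R]_n) (j : 'I_n) :
  mirror i c x ord0 j = if j == i then 2 * c - x ord0 j else x ord0 j.
Proof. by rewrite !mxE; case: eqP => _ /=; rewrite ?expr0 ?expr1; ring. Qed.

Lemma mirrorK n (i : 'I_n) (c : R) : involutive (mirror i c).
Proof.
by move=> x; apply/rowP => j; rewrite !mirrorE; case: eqP => // _; ring.
Qed.

(** Differences see only the linear part of the mirror, so a kernel in [x - y] that is invariant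
    under [reflection i] is unchanged when both points are mirrored. *)
Lemma mirrorB n (i : 'I_n) (c : R) (x y : 'rV[R]_n) :
  mirror i c x - mirror i c y = reflection i (x - y).
Proof.
by apply/rowP => j; rewrite !(mxE, mirrorE); case: eqP => // _; ring.
Qed.

End signed_translation.

(** * The gauge of an unconditional strictly convex body *)

Lemma bounded_set_norm_le (R : realType) n (A : set 'rV[R]_n) : bounded_set A ->
  exists2 C : R, 0 < C & forall x, A x -> `|x| <= C.
Proof.
move=> [M [_ hM]]; exists (`|M| + 1); first by rewrite ltr_wpDl.
by move=> x Ax; apply: hM => //; rewrite (le_lt_trans (ler_norm M))// ltrDl.
Qed.

Section gauge.
Variables (R : realType) (n : nat).
Implicit Types (x y z : 'rV[R]_n) (A K : set 'rV[R]_n).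

Lemma unconditional_reflection A i x : unconditional A ->
  A x -> A (reflection i x).
Proof. by move=> /(_ i) {2}<- Ax; exists x. Qed.

Lemma unconditional_opp A x : unconditional A -> A x -> A (- x).
Proof.
move=> uA Ax.
(* The first [k] coordinates are negated, one reflection at a time; [k = n] gives [- x]. *)
have h k : A (\row_j (if (j < k)%N then - x ord0 j else x ord0 j)).
  elim: k => [|k ih]; first by move: Ax; congr A; apply/rowP => j; rewrite !mxE.
  case: (ltnP k n) => kn.
    have := unconditional_reflection (Ordinal kn) uA ih.
    congr A; apply/rowP => j; rewrite !mxE -(inj_eq val_inj) /= ltnS.
    by case: (ltngtP j k).
  have jk (j : 'I_n) : (j < k)%N by exact: leq_trans (ltn_ord j) kn.
  by move: ih; congr A; apply/rowP => j; rewrite !mxE ltnS jk (ltnW (jk j)).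
by move: (h n); congr A; apply/rowP => j; rewrite !mxE ltn_ord.
Qed.

Variable K : set 'rV[R]_n.
Hypotheses (uK : unconditional K) (sK : strictly_convex_body K).

(** The origin is the midpoint of an interior point [p] and of [- p]; unless [p = 0], these are
    distinct points of [K], and strict convexity applies. *)
Lemma strictly_convex_body_interior0 : K^° 0.
Proof.
have [[_ _ [p Kp]] scvx] := sK.
have [p0|p0] := eqVneq p 0; first by rewrite -p0.
have Kp' : K p by exact: interior_subset.
have -> : 0 = (1 - 2^-1) *: p + 2^-1 *: - p.
  by rewrite scalerN -scalerBl [X in X - _ - _](splitr 1) mul1r addrK subrr scale0r.
apply: scvx => //; first exact: unconditional_opp.
  apply: contra_neq p0 => pN.
  have /eqP : 2 *: p = 0 by rewrite scaler_nat mulr2n {1}pN addNr.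
  by rewrite scaler_eq0 pnatr_eq0 => /eqP.
by rewrite invr_gt0 ltr0n invf_lt1 ?ltr1n.
Qed.

(** This keeps [inf] away from its default value. [K] contains a ball of radius [e] about the
    origin, and the factor [e / (|x| + 1)] brings [x] into it. *)
Lemma gauge_norm_has_inf x :
  has_inf [set r : R | 0 < r /\ K (r^-1 *: x)].
Proof.
split; last by exists 0 => r [/ltW].
have /nbhs_ballP[e /= e0 eK] := strictly_convex_body_interior0.
have x1 : 0 < `|x| + 1 by rewrite ltr_wpDl.
exists ((`|x| + 1) / e); split; first by rewrite divr_gt0.
apply: eK; rewrite -ball_normE /= sub0r normrN normrZ invf_div gtr0_norm ?divr_gt0//.
by rewrite mulrAC ltr_pdivrMr// ltr_pM2l// ltrDl.
Qed.

Lemma gauge_norm_ge0 x : 0 <= gauge_norm K x.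
Proof. by apply: lb_le_inf; [exact: (gauge_norm_has_inf x).1|move=> r [/ltW]]. Qed.

Lemma gauge_norm_le_scale (r : R) x : 0 < r -> gauge_norm K (r *: x) <= r * gauge_norm K x.
Proof.
move=> r0; rewrite -ler_pdivrMl//; apply: lb_le_inf.
  exact: (gauge_norm_has_inf x).1.
move=> t [t0 Kt]; rewrite ler_pdivrMl//; apply: (ge_inf (gauge_norm_has_inf _).2).
split; first exact: mulr_gt0.
by rewrite scalerA invfM mulrAC mulVf ?gt_eqF// mul1r.
Qed.

Lemma gauge_normZ (r : R) x : 0 < r -> gauge_norm K (r *: x) = r * gauge_norm K x.
Proof.
move=> r0; apply/eqP; rewrite eq_le gauge_norm_le_scale//=.
rewrite -ler_pdivlMl//.
have {1}-> : x = r^-1 *: (r *: x) by rewrite scalerA mulVf ?gt_eqF// scale1r.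
by apply: gauge_norm_le_scale; rewrite invr_gt0.
Qed.

Lemma gauge_norm_le r x : 0 < r -> gauge_norm K x <= r <-> K (r^-1 *: x).
Proof.
move=> r0; rewrite -(gauge_norm_le1 _ sK.1).
  by rewrite gauge_normZ ?invr_gt0// ler_pdivrMl// mulr1.
by move=> y; exact: unconditional_opp.
Qed.

Lemma gauge_norm_reflection i x : gauge_norm K (reflection i x) = gauge_norm K x.
Proof.
have rK y : reflection i (reflection i y) = y.
  by apply/rowP => j; rewrite !mxE; case: eqP; rewrite ?opprK.
congr inf; apply/seteqP; split=> r /= [r0 Kr]; split => //.
  have := unconditional_reflection i uK Kr; congr K.
  by apply/rowP => j; rewrite !mxE; case: eqP => //; rewrite mulrN opprK.
have := unconditional_reflection i uK Kr; congr K.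
by apply/rowP => j; rewrite !mxE; case: eqP => //; rewrite mulrN.
Qed.

(** [K] lies in a ball of some radius [D], which gives [c = D^-1]. This lets powers of the norm
    bound the perimeter kernel. *)
Lemma gauge_norm_ge_norm : exists2 c : R, 0 < c & forall x, c * `|x| <= gauge_norm K x.
Proof.
have [[cK _ _] _] := sK.
have [D D0 hD] := bounded_set_norm_le (compact_bounded cK).
exists D^-1; first by rewrite invr_gt0.
move=> x; apply: lb_le_inf; first exact: (gauge_norm_has_inf x).1.
move=> r [r0 Kr]; rewrite ler_pdivrMl// -ler_pdivrMr//.
by have := hD _ Kr; rewrite normrZ gtr0_norm ?invr_gt0// mulrC.
Qed.

Lemma gauge_norm_gt0 x : (0 < gauge_norm K x) = (x != 0).
Proof.
have [c c0 cK] := gauge_norm_ge_norm.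
have [->|x0] := eqVneq x 0; last first.
  by apply: (lt_le_trans _ (cK x)); rewrite mulr_gt0// normr_gt0.
(* Homogeneity at the origin says that the value there equals its own double. *)
have := @gauge_normZ 2 0; rewrite scaler0 => /(_ ltac:(lra)); lra.
Qed.

(** The point [x] lies strictly between [y] and [reflection i y], which have the same gauge [r]. By
    strict convexity [r^-1 *: x] is interior to [K], so its gauge is less than 1. *)
Lemma gauge_norm_lt i x y : `|x ord0 i| < `|y ord0 i| ->
  (forall j, j != i -> x ord0 j = y ord0 j) -> gauge_norm K x < gauge_norm K y.
Proof.
move=> xy xyj.
have yi0 : y ord0 i != 0.
  by apply: contraTneq xy => ->; rewrite normr0 -leNgt normr_ge0.
have y0 : y != 0 by apply: contra_neq yi0 => ->; rewrite mxE.
have r0 : 0 < gauge_norm K y by rewrite gauge_norm_gt0.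
set r := gauge_norm K y in r0 *.
have Ky : K (r^-1 *: y) by apply/gauge_norm_le.
have Kry : K (r^-1 *: reflection i y).
  by apply/gauge_norm_le; rewrite ?gauge_norm_reflection.
(* The solution of [(1 - 2 * l) * y_i = x_i], the only coordinate in which [y] and its reflection
   differ. *)
pose l := (1 - x ord0 i / y ord0 i) / 2.
have l01 : 0 < l < 1.
  have : `|x ord0 i / y ord0 i| < 1.
    by rewrite normrM normfV ltr_pdivrMr ?normr_gt0// mul1r.
  by rewrite ltr_norml /l; lra.
have : K^° (r^-1 *: x).
  have -> : r^-1 *: x = (1 - l) *: (r^-1 *: y) + l *: (r^-1 *: reflection i y).
    apply/rowP => j; rewrite !mxE; case: eqP => [->|/eqP ji].
      by rewrite /l; field; rewrite yi0 gt_eqF.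
    by rewrite (xyj _ ji); ring.
  apply: sK.2 => //; apply/eqP => /rowP/(_ i); rewrite !mxE eqxx => /eqP.
  rewrite mulrN -subr_eq0 opprK -mulr2n mulrn_eq0/= mulf_eq0 invr_eq0 (negbTE yi0).
  by rewrite (gt_eqF r0).
rewrite /interior/= => Kx.
(* An interior point may be dilated slightly within [K]; the factor [1 + e / 2] then gives the gauge
   bound [r / (1 + e / 2) < r]. *)
have : \forall t \near (1 : R), K (t *: (r^-1 *: x)).
  have : (fun t : R => t *: (r^-1 *: x)) t @[t --> (1 : R)] --> (1 : R) *: (r^-1 *: x).
    by apply: cvgZr_tmp; exact: cvg_id.
  by rewrite scale1r; exact.
move=> /nbhs_ballP[e /= e0 eK].
have t1 : 1 < 1 + e / 2 by lra.
have t0 : 0 < 1 + e / 2 by lra.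
have := eK (1 + e / 2); rewrite /ball/= opprD addNKr normrN gtr0_norm; last lra.
move=> /(_ ltac:(lra)); rewrite scalerA => h.
have /(gauge_norm_le x) [_] : 0 < r / (1 + e / 2) by rewrite divr_gt0.
rewrite invf_div => /(_ h) /le_lt_trans; apply.
by rewrite ltr_pdivrMr// ltr_pMr.
Qed.

(** The strict superlevel sets are open: the complement of a dilate of [K] for a positive level, the
    complement of the origin at level 0, and everything below. *)
Lemma measurable_gauge_norm : measurable_fun setT (gauge_norm K).
Proof.
apply: (measurability _ (RGenOInfty.measurableE R)).
move=> _ [_ [a ->] <-]; rewrite setTI; apply: sub_sigma_algebra.
rewrite (_ : _ @^-1` _ = [set x | a < gauge_norm K x]); last first.
  by apply/seteqP; split => x /=; rewrite in_itv/= andbT.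
have [a0|a0|->] := ltgtP a 0.
- rewrite (_ : mkset _ = setT); first exact: openT.
  by apply/seteqP; split => // x _ /=; exact: lt_le_trans (gauge_norm_ge0 x).
- rewrite (_ : mkset _ = (fun x => a^-1 *: x) @^-1` (~` K)).
    apply: open_comp; first by move=> x _; exact: scaler_continuous.
    apply: closed_openC; apply: compact_closed; first exact: norm_hausdorff.
    by have [[]] := sK.
  apply/seteqP; split => x /=; rewrite -gauge_norm_le// ltNge.
    by move/negP.
  by move/negP.
- rewrite (_ : mkset _ = [set~ 0]); last first.
    by apply/seteqP; split => x /=; rewrite gauge_norm_gt0 => /eqP.
  apply: closed_openC; apply: compact_closed; first exact: norm_hausdorff.
  exact: compact_set1.
Qed.

End gauge.

(** * Cubes and dyadic estimates *)

Section cube.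
Variables (R : realType) (n : nat).
Implicit Types (x y z : 'rV[R]_n).

Lemma measurable_box (a b : 'rV[R]_n) : measurable
  [set v : 'rV[R]_n | forall i, a ord0 i <= v ord0 i <= b ord0 i].
Proof.
rewrite (_ : mkset _ = \bigcap_(i : 'I_n)
    ((fun v : 'rV[R]_n => v ord0 i) @^-1` `[a ord0 i, b ord0 i])).
  apply: fin_bigcap_measurable => [|i _]; first exact: finite_finset.
  by rewrite -[X in measurable X]setTI; exact: (measurable_coord i).
apply/seteqP; split=> [v Bv i _|v Bv i].
  by rewrite /preimage/= in_itv/=; exact: Bv.
by have := Bv i I; rewrite /preimage/= in_itv.
Qed.

Definition cube (r : R) : set 'rV[R]_n :=
  [set v | forall i, - r <= v ord0 i <= r].

Let cubeE r : cube r = [set v : 'rV[R]_n | forall i,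
  (const_mx (- r) : 'rV[R]_n) ord0 i <= v ord0 i <= (const_mx r : 'rV[R]_n) ord0 i].
Proof. by apply/seteqP; split => v + i => /(_ i); rewrite !mxE. Qed.

Lemma measurable_cube r : measurable (cube r).
Proof. by rewrite cubeE; exact: measurable_box. Qed.

Lemma lebesgue_cube r : 0 <= r -> lebesgue_rV (cube r) = ((2 * r) ^+ n)%:E.
Proof.
move=> r0; rewrite cubeE lebesgue_rV_box => [|i]; last by rewrite !mxE; lra.
congr EFin; under eq_bigr do rewrite !mxE opprK -mulr2n -mulr_natl.
by rewrite prodr_const card_ord.
Qed.

Lemma cube_norm r x : 0 <= r -> cube r x <-> `|x| <= r.
Proof.
move=> r0; rewrite /Num.norm/= mx_normrE; split => [cx|xr i].
  by apply: bigmax_le => // -[i j] _ /=; rewrite ord1 ler_norml.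
rewrite -ler_norml; apply: le_trans xr.
exact: (le_bigmax _ (fun i : 'I_1 * 'I_n => `|x i.1 i.2|) (ord0, i)).
Qed.

End cube.
Arguments cube {R n} r.

Section dyadic.
Variable R : realType.
Implicit Types (x t s q : R).

Lemma powR_exprn x s m : 0 <= x -> (x ^+ m) `^ s = (x `^ s) ^+ m.
Proof. by move=> x0; rewrite -(powR_mulrn m x0) -(powR_mulrn m (powR_ge0 x s)) powRAC. Qed.

Lemma dyadic_bracket t : 1 <= t -> exists m, 2 ^+ m <= t <= 2 ^+ m.+1.
Proof.
move=> t1.
have ex : exists N, t < 2 ^+ N.
  exists (Num.bound t); have t0 : 0 <= t by rewrite (le_trans ler01).
  apply: (lt_le_trans (archi_boundP t0)).
  by rewrite -natrX ler_nat ltnW// ltn_expl.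
case: (ex_minnP ex) => -[|m]; first by rewrite expr0 ltNge t1.
move=> tm minm; exists m; rewrite (ltW tm) andbT leNgt.
by apply/negP => /minm; rewrite ltnn.
Qed.

Lemma bernoulli_expr t n : 0 <= t <= 1 -> 1 - n%:R * t <= (1 - t) ^+ n.
Proof.
move=> t01; elim: n => [|n ih]; first by rewrite expr0; lra.
rewrite exprS -natr1; apply: (le_trans _ (ler_wpM2l _ ih)); last lra.
rewrite -subr_ge0 (_ : _ - _ = n%:R * t ^+ 2); last by ring.
by rewrite mulr_ge0// sqr_ge0.
Qed.

(** Two ratios are allowed because the perimeter of a cube receives contributions from short and
    from long distances, which decay at different rates. *)
Lemma geometric_series_lty (K1 K2 q1 q2 : R) (u : nat -> \bar R) :
  0 <= K1 -> 0 <= K2 -> 0 <= q1 < 1 -> 0 <= q2 < 1 ->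
  (forall m, 0 <= u m)%E ->
  (forall m, u m <= (K1 * q1 ^+ m + K2 * q2 ^+ m)%:E)%E ->
  (\sum_(m <oo) u m < +oo)%E.
Proof.
move=> K10 K20 q1b q2b u0 uq.
apply: (@le_lt_trans _ _ (K1 / (1 - q1) + K2 / (1 - q2))%:E); last exact: ltry.
apply: lime_le; first exact: is_cvg_nneseries.
apply: nearW => N.
apply: (@le_trans _ _ (\sum_(0 <= m < N) (K1 * q1 ^+ m + K2 * q2 ^+ m)%:E)%E).
  exact: lee_sum.
rewrite sumEFin lee_fin big_split/= -!mulr_sumr.
have geo q : 0 <= q < 1 -> \sum_(0 <= i < N) q ^+ i <= (1 - q)^-1.
  move=> qb; have q1' : 0 < 1 - q by lra.
  rewrite -[leRHS]mul1r ler_pdivlMr// big_mkord.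
  have := subrX1 q N; have : 0 <= q ^+ N by rewrite exprn_ge0//; lra.
  by move: (q ^+ N) (\sum_(i < N) _) => a b; lra.
by apply: lerD; apply: ler_wpM2l => //; exact: geo.
Qed.

End dyadic.

(** * Polarization *)

Section iterated_integral.
Local Open Scope ereal_scope.
Context d1 d2 (T1 : measurableType d1) (T2 : measurableType d2) (R : realType).
Variables (m1 : {sigma_finite_measure set T1 -> \bar R})
          (m2 : {sigma_finite_measure set T2 -> \bar R}).

(** Setting [w] to zero outside [Y] in the second variable reduces this to the measurability part of
    Tonelli's theorem on the whole space. *)
Lemma measurable_fun_section_integral (w : T1 * T2 -> \bar R) (Y : set T2) :
  measurable_fun setT w -> (forall p, 0 <= w p) -> measurable Y ->
  measurable_fun setT (fun x => \int[m2]_(y in Y) w (x, y)).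
Proof.
move=> mw w0 mY.
pose w' := w \_ (snd @^-1` Y).
have mSY : measurable (@snd T1 T2 @^-1` Y).
  by rewrite -[X in measurable X]setTI; exact: measurable_snd.
have mw' : measurable_fun setT w'.
  apply/(measurable_restrictT _ mSY).
  exact: measurable_funTS.
have w'0 p : 0 <= w' p by exact: erestrict_ge0.
have := @measurable_fun_fubini_tonelli_F _ _ _ _ _ m2 _ mw' w'0.
congr measurable_fun; apply/funext => x; rewrite /fubini_F [RHS]integral_mkcond.
apply: eq_integral => y _; rewrite /w' /patch.
by rewrite (_ : ((x, y) \in snd @^-1` Y) = (y \in Y)).
Qed.

Lemma measure0_of_integral_pos d (T : measurableType d)
    (mu : {measure set T -> \bar R}) (D : set T) (f : T -> \bar R) :
  measurable D -> measurable_fun D f -> (forall x, D x -> 0 < f x) ->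
  \int[mu]_(x in D) f x = 0 -> mu D = 0.
Proof.
move=> mD mf f0 If.
have /(ae_eq_integral_abs _ mD mf) : \int[mu]_(x in D) `|f x| = 0.
  rewrite -[RHS]If; apply: eq_integral => x; rewrite inE => Dx.
  by rewrite gee0_abs// ltW// f0.
move=> [N [mN N0 DN]]; apply: (subset_measure0 mD mN _ N0).
move=> x Dx; apply: DN => /= /(_ Dx) /= fx0.
by have := f0 _ Dx; rewrite fx0 ltxx.
Qed.

(** On [A] times [B] one has [f = g + h] with [h > 0]. The finite integral of [g] cancels, so the
    integral of [h] vanishes, which is impossible if both sets have positive measure. *)
Lemma measure0_of_iterated_integral_lt (f g : T1 * T2 -> R) A B :
  measurable_fun setT f -> measurable_fun setT g ->
  (forall p, (0 <= f p)%R) -> (forall p, (0 <= g p)%R) ->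
  measurable A -> measurable B ->
  (forall x y, A x -> B y -> (g (x, y) < f (x, y))%R) ->
  \int[m1]_(x in A) \int[m2]_(y in B) (g (x, y))%:E < +oo ->
  \int[m1]_(x in A) \int[m2]_(y in B) (f (x, y))%:E <=
  \int[m1]_(x in A) \int[m2]_(y in B) (g (x, y))%:E ->
  m1 A = 0 \/ m2 B = 0.
Proof.
move=> mf mg f0 g0 mA mB gf goo fg.
(* The truncation makes [h] nonnegative everywhere, whereas [g < f] is known only on [A] times
   [B]. *)
pose h p := Num.max 0%R (f p - g p)%R.
have mh : measurable_fun setT h.
  by apply: measurable_maxr => //; exact: measurable_funB.
have h0 p : (0 <= h p)%R by rewrite /h le_max lexx.
have mgE : measurable_fun setT (fun p => (g p)%:E) by exact/measurable_EFinP.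
have mhE : measurable_fun setT (fun p => (h p)%:E) by exact/measurable_EFinP.
have g0E p : 0 <= (g p)%:E by rewrite lee_fin.
have h0E p : 0 <= (h p)%:E by rewrite lee_fin.
have mS (u : T1 * T2 -> R) : measurable_fun setT (fun p => (u p)%:E) -> forall x,
    measurable_fun B (fun y : T2 => (u (x, y))%:E).
  by move=> mu x; apply: measurable_funTS; exact: (measurable_fun_pair2 x mu).
have E : \int[m1]_(x in A) \int[m2]_(y in B) (f (x, y))%:E =
    \int[m1]_(x in A) \int[m2]_(y in B) (g (x, y))%:E +
    \int[m1]_(x in A) \int[m2]_(y in B) (h (x, y))%:E.
  rewrite -ge0_integralD//.
  - apply: eq_integral => x; rewrite inE => Ax.
    rewrite -ge0_integralD//; [|exact: (mS g)|exact: (mS h)].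
    apply: eq_integral => y; rewrite inE => By.
    rewrite -EFinD /h max_r ?subr_ge0 ?ltW ?gf//.
    by congr EFin; rewrite addrC subrK.
  - by move=> x _; exact: integral_ge0.
  - apply: measurable_funTS.
    exact: (measurable_fun_section_integral mgE).
  - by move=> x _; exact: integral_ge0.
  - apply: measurable_funTS.
    exact: (measurable_fun_section_integral mhE).
have [B0|B0] := eqVneq (m2 B) 0; first by right.
left; move: fg; rewrite E -[leRHS]adde0 leeD2lE ?ge0_fin_numE//; last first.
  by apply: integral_ge0 => x _; exact: integral_ge0.
move=> h00; apply: (@measure0_of_integral_pos _ _ m1 A
    (fun x => \int[m2]_(y in B) (h (x, y))%:E)) => //.
- by apply: measurable_funTS; exact: (measurable_fun_section_integral mhE).
- move=> x Ax; rewrite lt_neqAle integral_ge0// andbT eq_sym.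
  apply/eqP => /measure0_of_integral_pos => B0'; move/eqP : B0; apply.
  apply: B0' => //; first exact: (mS h).
  by move=> y By; rewrite lte_fin /h lt_max subr_gt0 gf ?orbT.
- apply/eqP; rewrite eq_le h00/=; apply: integral_ge0 => x _.
  exact: integral_ge0.
Qed.

End iterated_integral.

Section ereal_cancellation.
Local Open Scope ereal_scope.
Variable R : realType.
Implicit Types x : \bar R.

Lemma ge0_adde_fin (a b : \bar R) : (0 <= a) -> (0 <= b) -> (a + b < +oo) ->
  a \is a fin_num /\ b \is a fin_num.
Proof.
move=> a0 b0 ab; rewrite !ge0_fin_numE//; split.
  by apply: le_lt_trans ab; rewrite leeDl.
by apply: le_lt_trans ab; rewrite leeDr.
Qed.

(* The nine terms are the interactions between the three pieces of a set and the
   three pieces of its complement; polarization only changes two of them. *)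
Lemma ge0_adde_cancel x1 x2 x3 x4 x5 x6 x7 x8 x9 x6' x8' :
  0 <= x1 -> 0 <= x2 -> 0 <= x3 -> 0 <= x4 -> 0 <= x5 -> 0 <= x6 -> 0 <= x7 ->
  0 <= x8 -> 0 <= x9 -> 0 <= x6' -> 0 <= x8' -> x6' <= x6 -> x8' <= x8 ->
  (x1 + x2 + x3) + (x4 + x5 + x6) + (x7 + x8 + x9) < +oo ->
  (x1 + x2 + x3) + (x4 + x5 + x6) + (x7 + x8 + x9) <=
  (x1 + x2 + x3) + (x4 + x5 + x6') + (x7 + x8' + x9) ->
  x6 <= x6' /\ x6' < +oo.
Proof.
move=> h1 h2 h3 h4 h5 h6 h7 h8 h9 h6' h8' l6 l8 oo.
have [] := ge0_adde_fin _ _ oo; rewrite ?adde_ge0//.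
rewrite !fin_numD => /andP[/andP[/andP[f1 f2] f3] /andP[/andP[f4 f5] f6]].
move=> /andP[/andP[f7 f8] f9].
case: x6 f6 l6 h6 oo => // x6 _ l6 _ _; case: x8 f8 l8 h8 => // x8 _ l8 _.
case: x1 f1 h1 => // x1 _ _; case: x2 f2 h2 => // x2 _ _.
case: x3 f3 h3 => // x3 _ _; case: x4 f4 h4 => // x4 _ _.
case: x5 f5 h5 => // x5 _ _; case: x7 f7 h7 => // x7 _ _.
case: x9 f9 h9 => // x9 _ _; case: x6' l6 h6' => // x6' l6 _.
case: x8' l8 h8' => // x8' + _.
by rewrite -!EFinD !lee_fin ltry => l8 h; split => //; lra.
Qed.

End ereal_cancellation.

Section polarization.
Variables (R : realType) (n : nat) (k : 'rV[R]_n -> R).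
Hypotheses (mk : measurable_fun setT k) (k0 : forall z, 0 <= k z).
Hypothesis krefl : forall i z, k (reflection i z) = k z.
(* The condition [x != 0] is due to the junk value [k 0 = 0] of the kernel. *)
Hypothesis klt : forall i (x y : 'rV[R]_n), x != 0 ->
  `|x ord0 i| < `|y ord0 i| ->
  (forall j, j != i -> x ord0 j = y ord0 j) -> k y < k x.

(** For the perimeter kernel and [Y] the complement of [X], this is the fractional perimeter.
    Independent [X] and [Y] allow it to be split into pieces. *)
Definition interaction (X Y : set 'rV[R]_n) : \bar R :=
  (\int[@lebesgue_rV R n]_(x in X) \int[@lebesgue_rV R n]_(y in Y)
     (k (x - y))%:E)%E.

Lemma measurable_subr_rV :
  measurable_fun setT (fun p : 'rV[R]_n * 'rV[R]_n => p.1 - p.2).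
Proof.
apply: measurable_fun_rV => i; under eq_fun do rewrite !mxE.
apply: measurable_funB.
  by apply: (measurableT_comp (measurable_coord i)); exact: measurable_fst.
by apply: (measurableT_comp (measurable_coord i)); exact: measurable_snd.
Qed.

Let mkB : measurable_fun setT
  (fun p : 'rV[R]_n * 'rV[R]_n => (k (p.1 - p.2))%:E : \bar R).
Proof.
by apply/measurable_EFinP; apply: (measurableT_comp mk measurable_subr_rV).
Qed.

Let mksec (Y : set 'rV[R]_n) x : measurable_fun Y (fun y => (k (x - y))%:E).
Proof.
apply: measurable_funTS.
exact: (@measurable_fun_pair2 _ _ _ _ _ _
  (fun p : 'rV[R]_n * 'rV[R]_n => (k (p.1 - p.2))%:E) x mkB).
Qed.

Let mkint (X Y : set 'rV[R]_n) : measurable Y -> measurable_fun X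
  (fun x => (\int[@lebesgue_rV R n]_(y in Y) (k (x - y))%:E)%E).
Proof.
move=> mY; apply: measurable_funTS.
apply: (@measurable_fun_section_integral _ _ _ _ _ (@lebesgue_rV R n)
  (fun p : 'rV[R]_n * 'rV[R]_n => (k (p.1 - p.2))%:E) Y mkB _ mY).
by move=> p; rewrite lee_fin.
Qed.

Let kint0 (Y : set 'rV[R]_n) x :
  (0 <= \int[@lebesgue_rV R n]_(y in Y) (k (x - y))%:E)%E.
Proof. by apply: integral_ge0 => y _; rewrite lee_fin. Qed.

Lemma interaction_ge0 X Y : (0 <= interaction X Y)%E.
Proof. by apply: integral_ge0 => x _; exact: kint0. Qed.

Lemma interactionUl X1 X2 Y : measurable X1 -> measurable X2 -> measurable Y ->
  [disjoint X1 & X2] ->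
  interaction (X1 `|` X2) Y = (interaction X1 Y + interaction X2 Y)%E.
Proof.
move=> mX1 mX2 mY X12; rewrite /interaction ge0_integral_setU//.
exact: mkint.
Qed.

Lemma interactionUr X Y1 Y2 : measurable X -> measurable Y1 -> measurable Y2 ->
  [disjoint Y1 & Y2] ->
  interaction X (Y1 `|` Y2) = (interaction X Y1 + interaction X Y2)%E.
Proof.
move=> mX mY1 mY2 Y12; rewrite /interaction -ge0_integralD//.
- apply: eq_integral => x _; rewrite ge0_integral_setU//.
  by move=> y _; rewrite lee_fin.
- exact: mkint.
- exact: mkint.
Qed.

Section at_hyperplane.
Variables (i : 'I_n) (c : R).
Local Notation sigma := (mirror i c).

Lemma interaction_mirrorr X Y : measurable Y -> 
  interaction X (sigma @^-1` Y) =
  (\int[@lebesgue_rV R n]_(x in X) \int[@lebesgue_rV R n]_(y in Y)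
     (k (x - sigma y))%:E)%E.
Proof.
move=> mY; apply: eq_integral => x _.
rewrite -(@ge0_integral_signed_translation _ _ (fun j => j == i)
   (\row_j (if j == i then 2 * c else 0)) Y)//.
- by apply: eq_integral => y _; rewrite -[signed_translation _ _ _]/(sigma y) mirrorK.
- apply: measurable_funTS.
  apply/measurable_EFinP; apply: (measurableT_comp mk).
  apply: measurable_fun_rV => j; under eq_fun do rewrite mxE mxE mirrorE.
  by case: (j == i); do ?apply: measurable_funB => //; exact: measurable_coord.
- by move=> y _; rewrite lee_fin.
Qed.

(** Change variables in both integrals; the mirrored difference is a reflection of the original one,
    which [k] does not see. *)
Lemma interaction_mirror X Y : measurable X -> measurable Y ->
  interaction (sigma @^-1` X) (sigma @^-1` Y) = interaction X Y.
Proof.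
move=> mX mY; rewrite interaction_mirrorr; last exact: mY.
rewrite /interaction.
rewrite -[RHS](@ge0_integral_signed_translation _ _ (fun j => j == i)
   (\row_j (if j == i then 2 * c else 0)) X);
  [|exact: mX|exact: mkint mY|by move=> x _; exact: kint0].
apply: eq_integral => x _; apply: eq_integral => y _; congr EFin.
by rewrite -(krefl i) -(mirrorB i c) mirrorK.
Qed.


Let rVBE (u v : 'rV[R]_n) j : (u - v) ord0 j = u ord0 j - v ord0 j.
Proof. by rewrite !mxE. Qed.

Let H := [set x : 'rV[R]_n | c < x ord0 i].

(** If [u] and [v] are the positive heights of [x] and [y] above the hyperplane, the differences
    have [i]-th coordinates [u + v] and [u - v], and they agree in all others. *)
Let kmirror_lt x y : H x -> H y -> x != y -> k (x - sigma y) < k (x - y).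
Proof.
move=> Hx Hy xy; apply: (klt (i := i)).
- by rewrite subr_eq0.
- rewrite !rVBE mirrorE eqxx.
  move: Hx Hy; rewrite /H/= => Hx Hy.
  rewrite [ltRHS]gtr0_norm; last lra.
  by rewrite ltr_norml; apply/andP; split; lra.
- by move=> j ji; rewrite !rVBE mirrorE (negbTE ji).
Qed.

Let mkBm : measurable_fun setT
  (fun p : 'rV[R]_n * 'rV[R]_n => k (p.1 - sigma p.2)).
Proof.
apply: (measurableT_comp mk).
have : measurable_fun setT (fun p : 'rV[R]_n * 'rV[R]_n => (p.1, sigma p.2)).
  apply: measurable_fun_pair; first exact: measurable_fst.
  apply: (measurableT_comp (measurable_signed_translation _ _)).
  exact: measurable_snd.
exact: (measurableT_comp measurable_subr_rV).
Qed.

Lemma interaction_mirrorr_le X Y : measurable X -> measurable Y ->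
  X `<=` H -> Y `<=` H -> [disjoint X & Y] ->
  (interaction X (sigma @^-1` Y) <= interaction X Y)%E.
Proof.
move=> mX mY XH YH XY; rewrite interaction_mirrorr; last exact: mY.
have mkBmE : measurable_fun setT
    (fun p : 'rV[R]_n * 'rV[R]_n => (k (p.1 - sigma p.2))%:E).
  exact/measurable_EFinP.
apply: ge0_le_integral => //.
- by move=> x _; apply: integral_ge0 => y _; rewrite lee_fin.
- apply: measurable_funTS.
  apply: (@measurable_fun_section_integral _ _ _ _ _ (@lebesgue_rV R n)
    (fun p : 'rV[R]_n * 'rV[R]_n => (k (p.1 - sigma p.2))%:E) Y mkBmE _ mY).
  by move=> p; rewrite lee_fin.
- exact: mkint.
move=> x Xx; apply: ge0_le_integral => //.
- by move=> y _; rewrite lee_fin.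
- apply: measurable_funTS.
  exact: (@measurable_fun_pair2 _ _ _ _ _ _
    (fun p : 'rV[R]_n * 'rV[R]_n => (k (p.1 - sigma p.2))%:E) x mkBmE).
(* Disjointness of [X] and [Y] excludes the diagonal. *)
- move=> y Yy; rewrite lee_fin ltW// kmirror_lt//; [exact: XH|exact: YH|].
  apply/eqP => xy; move: XY; rewrite disj_set2E => /eqP/seteqP[+ _] => /(_ x).
  by apply; split => //; rewrite xy.
Qed.

(** Of the nine interactions that make up each perimeter, seven agree by mirror symmetry. In the
    other two, both between [A] and [B] before polarization, one set is moved to the other side of
    the hyperplane, so they cannot grow. If the sum does not drop, neither do they, and the strict
    inequality of the kernels forces [A] or [B] to be null. *)
Lemma interaction_polarization (E : set 'rV[R]_n) :
  let B' := [set x | E x /\ x ord0 i < c /\ ~ E (sigma x)] in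
  measurable E -> (interaction E (~` E) < +oo)%E ->
  (interaction E (~` E) <=
   interaction ((E `\` B') `|` sigma @^-1` B')
     (~` ((E `\` B') `|` sigma @^-1` B')))%E ->
  lebesgue_rV [set x | E x /\ c < x ord0 i /\ ~ E (sigma x)] = 0%E \/
  lebesgue_rV B' = 0%E.
Proof.
move=> B' mE PE.
set A := [set x | E x /\ c < x ord0 i /\ ~ E (sigma x)].
(* [E = S u A u B'] with [S] symmetric, and polarization replaces [B'] by its
   mirror image [B]; [A'] is the mirror image of [A]. *)
pose A' := [set x | ~ E x /\ x ord0 i < c /\ E (sigma x)].
pose B := [set x | ~ E x /\ c < x ord0 i /\ E (sigma x)].
pose S := [set x | E x /\ E (sigma x)].
pose S' := [set x | ~ E x /\ ~ E (sigma x)].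
have si x : sigma x ord0 i = 2 * c - x ord0 i by rewrite mirrorE eqxx.
have sfix (x : 'rV[R]_n) : x ord0 i = c -> sigma x = x.
  by move=> xc; apply/rowP => j; rewrite mirrorE; case: eqP => // ->; rewrite xc; ring.
(* Points of the hyperplane itself are fixed, hence they fall into [S] or [S']. *)
have pos (x : 'rV[R]_n) : [\/ c < x ord0 i, x ord0 i < c | sigma x = x].
  by case: (ltgtP c (x ord0 i)) => [h|h|h]; [exact: Or31|exact: Or32|exact/Or33/sfix/esym].
have hh (x : 'rV[R]_n) : x ord0 i < c -> c < x ord0 i -> False.
  by move=> /lt_trans/[apply]; rewrite ltxx.
have sB : sigma @^-1` B' = B.
  apply/seteqP; split => x /=; rewrite /B' /B /= si mirrorK => -[a [b d]]; do ?split => //; lra.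
have sB' : sigma @^-1` B = B'.
  apply/seteqP; split => x /=; rewrite /B' /B /= si mirrorK => -[a [b d]]; do ?split => //; lra.
have sA : sigma @^-1` A = A'.
  apply/seteqP; split => x /=; rewrite /A' /A /= si mirrorK => -[a [b d]]; do ?split => //; lra.
have sA' : sigma @^-1` A' = A.
  apply/seteqP; split => x /=; rewrite /A' /A /= si mirrorK => -[a [b d]]; do ?split => //; lra.
have sS : sigma @^-1` S = S.
  by apply/seteqP; split => x /=; rewrite /S /= mirrorK => -[].
have sS' : sigma @^-1` S' = S'.
  by apply/seteqP; split => x /=; rewrite /S' /= mirrorK => -[].
have msE : measurable (sigma @^-1` E).
  exact: measurable_signed_translation_preimage.
have mH : measurable H.
  rewrite (_ : H = (fun x : 'rV[R]_n => x ord0 i) @^-1` `]c, +oo[).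
    by rewrite -[X in measurable X]setTI; exact: (measurable_coord i).
  by apply/seteqP; split => x /=; rewrite in_itv/= andbT.
have mA : measurable A.
  rewrite (_ : A = E `&` H `&` ~` (sigma @^-1` E)).
    by apply: measurableI; [exact: measurableI|exact: measurableC].
  by apply/seteqP; split => x /=; [move=> -[? []]|move=> -[[]]].
have mB : measurable B.
  rewrite (_ : B = ~` E `&` H `&` (sigma @^-1` E)).
    by apply: measurableI => //; apply: measurableI => //; exact: measurableC.
  by apply/seteqP; split => x /=; [move=> -[? []]|move=> -[[]]].
have mS : measurable S by exact: measurableI.
have mS' : measurable S'.
  by apply: measurableI; exact: measurableC.
have mA' : measurable A'.
  by rewrite -sA; exact: measurable_signed_translation_preimage.
have mB' : measurable B'.
  by rewrite -sB'; exact: measurable_signed_translation_preimage.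
have EE : E = S `|` A `|` B'.
  apply/seteqP; split => x; last by rewrite /S /A /B' /= => -[[]|] [].
  rewrite /S /A /B' /= => Ex; have [sx|sx] := pselect (E (sigma x)); first by left; left.
  by case: (pos x) => [h|h|h]; [left; right|right|rewrite h in sx].
have EC : ~` E = S' `|` A' `|` B.
  apply/seteqP; split => x; last by rewrite /S' /A' /B /= => -[[]|] [].
  rewrite /S' /A' /B /= => Ex; have [sx|sx] := pselect (E (sigma x)); last by left; left.
  by case: (pos x) => [h|h|h]; [right|left; right|rewrite h in sx].
rewrite sB; set E' := (E `\` B') `|` B.
have E'E : E' = S `|` A `|` B.
  apply/seteqP; split => x; rewrite /E' {1}EE /S /A /B' /B /=; first tauto.
  by case; [|by right]; case => -[? h]; left; split; try tauto; case: h => ? ?; lra.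
have E'C : ~` E' = S' `|` A' `|` B'.
  apply/seteqP; split => x; rewrite E'E /S /A /B' /B /S' /A' /=.
    by case: (pos x) => [h|h|->]; have [Ex|Ex] := pselect (E x);
      have [sx|sx] := pselect (E (sigma x)); tauto.
  by case=> [[[? ?]|[? [? ?]]]|[? [? ?]]] [[[? ?]|[? [? ?]]]|[? [? ?]]] //; exact: (hh x).
have dis (X Y : set 'rV[R]_n) : (forall x, X x -> Y x -> False) -> [disjoint X & Y].
  move=> XY; rewrite disj_set2E; apply/eqP/seteqP; split => // x [Xx Yx].
  exact: XY Xx Yx.
have dSA : [disjoint S & A] by apply: dis; rewrite /S /A /=; tauto.
have dSAB' : [disjoint (S `|` A) & B'].
  by apply: dis; rewrite /S /A /B' /= => x [[? ?]|[? [? ?]]] [? [? ?]]//; exact: (hh x).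
have dSAB : [disjoint (S `|` A) & B] by apply: dis; rewrite /S /A /B /=; tauto.
have dSA' : [disjoint S' & A'] by apply: dis; rewrite /S' /A' /=; tauto.
have dSA'B : [disjoint (S' `|` A') & B].
  by apply: dis; rewrite /S' /A' /B /= => x [[? ?]|[? [? ?]]] [? [? ?]]//; exact: (hh x).
have dSA'B' : [disjoint (S' `|` A') & B'] by apply: dis; rewrite /S' /A' /B' /=; tauto.
have dAB : [disjoint A & B] by apply: dis; rewrite /A /B /=; tauto.
have dBA : [disjoint B & A] by apply: dis; rewrite /A /B /=; tauto.
have AH : A `<=` H by move=> x [_ []].
have BH : B `<=` H by move=> x [_ []].
have mU := @measurableU _ 'rV[R]_n.
have mSA := mU _ _ mS mA; have mSA' := mU _ _ mS' mA'.
have I3 (X Y Z X' Y' Z' : set 'rV[R]_n) : measurable X -> measurable Y -> measurable Z ->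
    measurable X' -> measurable Y' -> measurable Z' ->
    [disjoint X & Y] -> [disjoint (X `|` Y) & Z] ->
    [disjoint X' & Y'] -> [disjoint (X' `|` Y') & Z'] ->
    interaction (X `|` Y `|` Z) (X' `|` Y' `|` Z') =
    ((interaction X X' + interaction X Y' + interaction X Z') +
     (interaction Y X' + interaction Y Y' + interaction Y Z') +
     (interaction Z X' + interaction Z Y' + interaction Z Z'))%E.
  move=> mX mY mZ mX' mY' mZ' d1 d2 d3 d4.
  have mXY := mU _ _ mX mY; have mXY' := mU _ _ mX' mY'; have mXYZ' := mU _ _ mXY' mZ'.
  rewrite (interactionUl mXY mZ mXYZ' d2) (interactionUl mX mY mXYZ' d1).
  rewrite (interactionUr mX mXY' mZ' d4) (interactionUr mX mX' mY' d3).
  rewrite (interactionUr mY mXY' mZ' d4) (interactionUr mY mX' mY' d3).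
  by rewrite (interactionUr mZ mXY' mZ' d4) (interactionUr mZ mX' mY' d3).
(* The mirror fixes [S] and [S'] and exchanges [A] with [A'] and [B] with [B']. The equalities [e1]
   to [e4] match the two expansions except for the terms in [l1] and [l2]. *)
have e1 : interaction S B' = interaction S B.
  by rewrite -{1}sS -sB'; exact: interaction_mirror.
have e2 : interaction B' S' = interaction B S'.
  by rewrite -{1}sS' -sB'; exact: interaction_mirror.
have e3 : interaction B' B = interaction B B'.
  by rewrite -{1}sB -{1}sB'; exact: interaction_mirror.
have e4 : interaction B' A' = interaction B A.
  by rewrite -sA -sB'; exact: interaction_mirror.
have l1 : (interaction A B' <= interaction A B)%E.
  by rewrite -sB'; exact: interaction_mirrorr_le.
have l2 : (interaction B A' <= interaction B A)%E.
  by rewrite -sA; exact: interaction_mirrorr_le.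
have PEE : interaction E (~` E) = interaction (S `|` A `|` B') (S' `|` A' `|` B).
  by rewrite -EE -EC.
have PE'E : interaction E' (~` E') = interaction (S `|` A `|` B) (S' `|` A' `|` B').
  by rewrite E'C -E'E.
move: PE; rewrite PEE PE'E !I3// e1 e2 e3 e4.
have I0 := interaction_ge0.
move=> PE AB_le.
have [AB_AB' AB'_oo] := ge0_adde_cancel (I0 _ _) (I0 _ _) (I0 _ _) (I0 _ _) (I0 _ _)
  (I0 _ _) (I0 _ _) (I0 _ _) (I0 _ _) (I0 _ _) (I0 _ _) l1 l2 PE AB_le.
have IAB' : interaction A B' = (\int[@lebesgue_rV R n]_(x in A)
    \int[@lebesgue_rV R n]_(y in B) (k (x - sigma y))%:E)%E.
  by rewrite -sB'; exact: interaction_mirrorr.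
rewrite IAB' in AB_AB' AB'_oo.
have kAB x y : A x -> B y -> k (x - sigma y) < k (x - y).
  move=> Ax By; apply: kmirror_lt; [exact: AH|exact: BH|].
  by apply/eqP => xy; move: Ax By; rewrite xy /A /B /=; tauto.
have mkBr : measurable_fun setT
    (fun p : 'rV[R]_n * 'rV[R]_n => k (p.1 - p.2)).
  exact: (measurableT_comp mk measurable_subr_rV).
have [A0|B0] := @measure0_of_iterated_integral_lt _ _ _ _ R
  (@lebesgue_rV R n) (@lebesgue_rV R n)
  (fun p : 'rV[R]_n * 'rV[R]_n => k (p.1 - p.2))
  (fun p : 'rV[R]_n * 'rV[R]_n => k (p.1 - sigma p.2)) A B mkBr mkBm
  (fun p => k0 _) (fun p => k0 _) mA mB kAB AB'_oo AB_AB'.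
- by left.
- right; rewrite -B0 -sB; apply/esym.
  exact: lebesgue_rV_signed_translation.
Qed.

End at_hyperplane.
End polarization.

(** * Finiteness of the perimeter of a cube *)

Section interaction_cube.
Variables (R : realType) (n : nat) (s C : R) (k : 'rV[R]_n -> R).
Hypotheses (mk : measurable_fun setT k) (k0 : forall z, 0 <= k z).
Hypotheses (s01 : 0 < s < 1) (C0 : 0 <= C).
Hypothesis kC : forall z, z != 0 -> k z <= C * (`|z| `^ (n%:R + s))^-1.

(* Dyadic bound of [k (x - y)] for [x] in the cube [Q] and [y] outside: if
   [`|x - y| <= 2 ^- m], then [x] lies in the shell [Qm m], of measure
   [O(2 ^- m)]. *)
Let h m : R := 2^-1 ^+ m.
Let c m : R := C * (h m.+1 `^ (n%:R + s))^-1.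
Let d m : R := C * ((2 ^+ m) `^ (n%:R + s))^-1.
Let Q : set 'rV[R]_n := cube 1.
Let Qm m : set 'rV[R]_n := Q `\` cube (1 - h m).
Let S (r : R) (x : 'rV[R]_n) : set 'rV[R]_n := [set y | cube r (x - y)].
(** The first summand serves distances between [h m.+1] and [h m], the second those between [2 ^+ m]
    and [2 ^+ m.+1]; [c m] and [d m] bound the kernel there. *)
Let t m (x y : 'rV[R]_n) : R :=
  c m * \1_(Qm m) x * \1_(S (h m) x) y + d m * \1_(S (2 ^+ m.+1) x) y.

Let h01 m : 0 < h m <= 1.
Proof. by rewrite exprn_gt0 ?exprn_ile1//; lra. Qed.

Let c0 m : 0 <= c m. Proof. by rewrite mulr_ge0// invr_ge0 powR_ge0. Qed.
Let d0 m : 0 <= d m. Proof. by rewrite mulr_ge0// invr_ge0 powR_ge0. Qed.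
Let i0 (A : set 'rV[R]_n) x : 0 <= \1_A x :> R.
Proof. by rewrite indicE ler0n. Qed.

Let ci0 m x : 0 <= c m * \1_(Qm m) x.
Proof. by apply: mulr_ge0; [exact: c0|exact: i0]. Qed.

Let di0 m (A : set 'rV[R]_n) x : 0 <= d m * \1_A x.
Proof. by apply: mulr_ge0; [exact: d0|exact: i0]. Qed.

Let t0 m x y : 0 <= t m x y.
Proof.
apply: addr_ge0; last exact: di0.
by apply: mulr_ge0; [exact: ci0|exact: i0].
Qed.

Let SE r x : S r x = signed_translation (fun=> true) x @^-1` cube r.
Proof.
apply/seteqP; split => y yS i; move: (yS i); rewrite !mxE/= expr1 mulN1r addrC//.
Qed.

Let mS r x : measurable (S r x).
Proof.
by rewrite SE; apply: measurable_signed_translation_preimage; exact: measurable_cube.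
Qed.

Let lS r x : 0 <= r -> lebesgue_rV (S r x) = ((2 * r) ^+ n)%:E.
Proof.
move=> r0; rewrite SE lebesgue_rV_signed_translation; first exact: lebesgue_cube.
exact: measurable_cube.
Qed.

Let mQ : measurable Q. Proof. exact: measurable_cube. Qed.
Let mQm m : measurable (Qm m).
Proof. by apply: measurableD; exact: measurable_cube. Qed.

(** The shell is a difference of concentric cubes, of volume [2 ^+ n * (1 - (1 - h m) ^+ n)];
    Bernoulli's inequality makes this linear in [h m]. *)
Let lQm m : exists2 l : R, lebesgue_rV (Qm m) = l%:E &
  0 <= l <= 2 ^+ n * n%:R * h m.
Proof.
have := h01 m => hm.
have sub : cube (1 - h m) `<=` Q.
  by move=> x + i => /(_ i); lra.
have E : lebesgue_rV (Qm m) = ((2 * 1) ^+ n - (2 * (1 - h m)) ^+ n)%:E.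
  rewrite measureD//; last 2 first.
  - exact: measurable_cube.
  - by rewrite [ltLHS]lebesgue_cube// ltry.
  rewrite setIidr// EFinB; congr (_ - _)%E; apply: lebesgue_cube; lra.
exists ((2 * 1) ^+ n - (2 * (1 - h m)) ^+ n) => //.
apply/andP; split.
  by rewrite subr_ge0 lerXn2r// ?nnegrE; lra.
rewrite !exprMn expr1n mulr1 -[X in X - _]mulr1 -mulrBr -mulrA ler_pM2l ?exprn_gt0//.
have := @bernoulli_expr R (h m) n; lra.
Qed.

Let k_le_t x y : Q x -> ~ Q y -> exists m, k (x - y) <= t m x y.
Proof.
move=> Qx Qy.
have xy : x != y by apply/eqP => xy; apply: Qy; rewrite -xy.
set r := `|x - y|; have r0 : 0 < r by rewrite normr_gt0 subr_eq0.
have p0 : 0 <= n%:R + s by rewrite addr_ge0// ltW//; case/andP: s01.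
have kle (a : R) : 0 < a -> a <= r -> k (x - y) <= C * (a `^ (n%:R + s))^-1.
  move=> a0 ar; apply: (le_trans (kC _)); first by rewrite subr_eq0.
  rewrite ler_wpM2l// lef_pV2 ?posrE ?powR_gt0//.
  by rewrite ge0_ler_powR// ?nnegrE ltW.
have inS (a : R) : r <= a -> \1_(S a x) y = 1 :> R.
  move=> ra; rewrite indicE mem_set// /S /=; apply/cube_norm => //.
  by apply: le_trans ra; exact: ltW.
have [r1|r1] := leP r 1.
  have [m /andP[mr rm]] := @dyadic_bracket R r^-1 ltac:(by rewrite invf_ge1).
  exists m; have hE : h m = (2 ^+ m)^-1 by rewrite /h exprVn.
  have hE1 : h m.+1 = (2 ^+ m.+1)^-1 by rewrite /h exprVn.
  have rh : r <= h m by rewrite hE -[r]invrK lef_pV2 ?posrE ?invr_gt0 ?exprn_gt0.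
  have hr : h m.+1 <= r.
    by rewrite hE1 -[r]invrK lef_pV2 ?posrE ?invr_gt0 ?exprn_gt0.
  apply: (@le_trans _ _ (c m)); first by apply: kle => //; case/andP: (h01 m.+1).
  (* Were [x] in the cube of radius [1 - h m], the point [y], at distance at most [h m], would lie
     in [Q]. *)
  have Qmx : Qm m x.
    split => // xh; apply: Qy; apply/cube_norm => //.
    have hm1 : 0 <= 1 - h m by rewrite subr_ge0; case/andP: (h01 m).
    move/(cube_norm _ hm1) : xh => xh.
    have -> : y = x - (x - y) by rewrite opprB addrC subrK.
    by apply: (le_trans (ler_normB _ _)); rewrite -/r; lra.
  by rewrite /t inS// mulr1 indicE mem_set// mulr1 lerDl.
have [m /andP[mr rm]] := @dyadic_bracket R r (ltW r1).
exists m; apply: (@le_trans _ _ (d m)); first by apply: kle => //; rewrite exprn_gt0.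
rewrite /t (inS (2 ^+ m.+1))// mulr1 lerDr.
by apply: mulr_ge0; [exact: ci0|exact: i0].
Qed.

(** The integral of [t m x] over the whole space: the cube [S r x] has volume [(2 * r) ^+ n]. *)
Let U m x : R := c m * \1_(Qm m) x * (2 * h m) ^+ n + d m * (2 * 2 ^+ m.+1) ^+ n.

Let mt m x (D : set 'rV[R]_n) : measurable_fun D (fun y => (t m x y)%:E).
Proof.
by apply/measurable_EFinP/measurable_funTS; apply: measurable_funD;
  apply: measurable_funM => //; exact: measurable_indic.
Qed.

Let int_t m x (D : set 'rV[R]_n) : measurable D ->
  (\int[@lebesgue_rV R n]_(y in D) (t m x y)%:E <= (U m x)%:E)%E.
Proof.
move=> mD; apply: (@le_trans _ _ (\int[@lebesgue_rV R n]_y (t m x y)%:E)%E).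
  apply: ge0_subset_integral => //.
  by move=> y _; rewrite lee_fin.
have indE (a : R) (A : set 'rV[R]_n) : 0 <= a -> measurable A ->
    (\int[@lebesgue_rV R n]_y (a * \1_A y)%:E = a%:E * lebesgue_rV A)%E.
  move=> a0 mA; rewrite (integralZl_indic _ (fun=> A)) ?integral_indic ?setIT//.
  by rewrite ltNge a0.
have mi (a : R) (A : set 'rV[R]_n) : measurable A ->
    measurable_fun setT (fun y => (a * \1_A y)%:E).
  by move=> mA; apply/measurable_EFinP/measurable_funM => //; exact: measurable_indic.
under eq_integral do rewrite /t EFinD.
rewrite ge0_integralD//; last 4 first.
- by move=> y _; rewrite lee_fin; apply: mulr_ge0; [exact: ci0|exact: i0].
- exact: mi.
- by move=> y _; rewrite lee_fin; exact: di0.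
- exact: mi.
rewrite !indE//.
by rewrite !lS ?mulr_ge0 ?exprn_ge0 // -?EFinM -?EFinD lee_fin; case/andP: (h01 m) => /ltW.
Qed.

(** At distance about [h = h m] the kernel is of order [h] to the power [- (n + s)], the cube around
    [x] contributes [h ^+ n] and the shell a factor [h], in total [h] to the power [1 - s]. Distance
    [2 ^+ m] contributes [2] to the power [- m * s]. Both are summable because [0 < s < 1]. *)
Lemma interaction_cube_lty : (interaction k Q (~` Q) < +oo)%E.
Proof.
have mU m (D : set 'rV[R]_n) : measurable_fun D (fun x => (U m x)%:E).
  apply/measurable_EFinP/measurable_funTS; apply: measurable_funD => //.
  by do 2 apply: measurable_funM => //; exact: measurable_indic.
have U0 m x : 0 <= U m x.
  apply: addr_ge0; apply: mulr_ge0; [exact: ci0| |exact: d0|].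
    by rewrite exprn_ge0// mulr_ge0//; case/andP: (h01 m) => /ltW.
  by rewrite exprn_ge0// mulr_ge0// exprn_ge0.
have inner x : Q x -> (\int[@lebesgue_rV R n]_(y in ~` Q) (k (x - y))%:E <=
    \sum_(m <oo) (U m x)%:E)%E.
  move=> Qx; apply: (@le_trans _ _
    (\int[@lebesgue_rV R n]_(y in ~` Q) \sum_(m <oo) (t m x y)%:E)%E).
    apply: ge0_le_integral.
    - exact: measurableC.
    - by move=> y _; rewrite lee_fin.
    - apply: measurable_funTS; apply/measurable_EFinP; apply: (measurableT_comp mk).
      apply: measurable_fun_rV => j; under eq_fun do rewrite !mxE.
      by apply: measurable_funB => //; exact: measurable_coord.
    - by apply: ge0_emeasurable_sum => [m y _ _|m _]; [rewrite lee_fin|exact: mt].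
    - move=> y Qy; have [m km] := k_le_t Qx Qy.
      apply: (@le_trans _ _ (t m x y)%:E); first by rewrite lee_fin.
      apply: (@le_trans _ _ (\sum_(0 <= j < m.+1) (t j x y)%:E)%E).
        by rewrite big_nat_recr//= leeDr// sume_ge0// => j _; rewrite lee_fin.
      by apply: nneseries_lim_ge => j _ _; rewrite lee_fin.
  rewrite integral_nneseries//; [|exact: measurableC|by move=> m y _; rewrite lee_fin].
  apply: lee_nneseries => m _.
    by move=> _; apply: integral_ge0 => y _; rewrite lee_fin.
  by apply: int_t; exact: measurableC.
apply: (@le_lt_trans _ _
  (\int[@lebesgue_rV R n]_(x in Q) \sum_(m <oo) (U m x)%:E)%E).
  apply: ge0_le_integral => //.
  - by move=> x _; apply: integral_ge0 => y _; rewrite lee_fin.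
  - apply: measurable_funTS.
    apply: (@measurable_fun_section_integral _ _ _ _ _ (@lebesgue_rV R n)
      (fun p : 'rV[R]_n * 'rV[R]_n => (k (p.1 - p.2))%:E)).
    + apply/measurable_EFinP; apply: (measurableT_comp mk).
      exact: measurable_subr_rV.
    + by move=> p; rewrite lee_fin.
    + exact: measurableC.
  - by apply: ge0_emeasurable_sum => [m x _ _|m _]; [rewrite lee_fin|exact: mU].
rewrite integral_nneseries//; last by move=> m x _; rewrite lee_fin.
pose g := (2^-1 : R) `^ (1 - s).
pose q := ((2 : R) `^ s)^-1.
have pow1 (a : R) : (1 : R) `^ a = 1 by rewrite powR1.
have g01 : 0 <= g < 1.
  rewrite powR_ge0/= -[ltRHS](pow1 (1 - s)).
  by apply: gt0_ltr_powR; rewrite ?nnegrE ?subr_gt0 ?invr_ge0 ?invf_lt1 ?ltr1n//; case/andP: s01.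
have q01 : 0 <= q < 1.
  rewrite invr_ge0 powR_ge0/= invf_lt1 ?powR_gt0//.
  rewrite -[ltLHS](pow1 s).
  by apply: gt0_ltr_powR; rewrite ?nnegrE ?ltr1n//; case/andP: s01.
apply: (@geometric_series_lty R (C * 4 ^+ n * (2 ^+ n * n%:R * 2 * g))
   (C * 4 ^+ n * 2 ^+ n) g q) => //.
- by rewrite !mulr_ge0 ?exprn_ge0//; case/andP: g01.
- by rewrite !mulr_ge0 ?exprn_ge0.
- by move=> m; apply: integral_ge0 => x _; rewrite lee_fin.
move=> m.
have [l lE /andP[l0 lh]] := lQm m.
have hE : h m = 2 * h m.+1 by rewrite /h exprS; lra.
have hm : 0 < h m.+1 by case/andP: (h01 m.+1).
(* The volume of the cube cancels the part [n] of the exponent [n + s]; the 4 comes from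
   [2 * h m = 4 * h m.+1]. *)
have cE : c m * (2 * h m) ^+ n = C * 4 ^+ n / h m.+1 `^ s.
  rewrite /c hE powRD; last by rewrite (gt_eqF hm) implybT.
  rewrite powR_mulrn; last exact: ltW.
  rewrite (_ : 2 * (2 * h m.+1) = 4 * h m.+1); last by ring.
  rewrite exprMn; field.
  by rewrite gt_eqF ?powR_gt0//= expf_neq0// gt_eqF.
have dE : d m * (2 * 2 ^+ m.+1) ^+ n = C * 4 ^+ n * q ^+ m.
  have m2 : 0 < (2 : R) ^+ m by rewrite exprn_gt0.
  rewrite /d powRD; last by rewrite (gt_eqF m2) implybT.
  rewrite powR_mulrn; last exact: ltW.
  rewrite powR_exprn// (_ : 2 * 2 ^+ m.+1 = 4 * 2 ^+ m); last by rewrite exprS; ring.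
  rewrite exprMn /q exprVn; field.
  by rewrite !expf_neq0 ?gt_eqF ?powR_gt0.
have hg : h m.+1 / h m.+1 `^ s = g ^+ m.+1.
  rewrite /g -powR_exprn// -/(h m.+1) powRB; last by rewrite (gt_eqF hm) implybT.
  by rewrite powRr1// ltW.
have indE (A : set 'rV[R]_n) (a : R) : 0 <= a -> measurable A ->
    (\int[@lebesgue_rV R n]_(x in Q) (a * \1_A x)%:E = a%:E * lebesgue_rV (A `&` Q))%E.
  move=> a0 mA; rewrite (integralZl_indic mQ (fun=> A)) ?integral_indic//.
  by rewrite ltNge a0.
have -> : (\int[@lebesgue_rV R n]_(x in Q) (U m x)%:E =
    (C * 4 ^+ n / h m.+1 `^ s * l + C * 4 ^+ n * q ^+ m * 2 ^+ n)%:E)%E.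
  pose a := C * 4 ^+ n / h m.+1 `^ s; pose b := C * 4 ^+ n * q ^+ m.
  have a0 : 0 <= a by rewrite !mulr_ge0 ?exprn_ge0// invr_ge0 powR_ge0.
  have b0 : 0 <= b by rewrite !mulr_ge0 ?exprn_ge0//; case/andP: q01.
  transitivity (\int[@lebesgue_rV R n]_(x in Q)
      ((a * \1_(Qm m) x)%:E + (b * \1_Q x)%:E))%E.
    apply: eq_integral => x; rewrite inE => Qx; rewrite -EFinD; congr EFin.
    by rewrite /U mulrAC cE dE /a /b [\1_Q x]indicE mem_set// mulr1.
  rewrite ge0_integralD//; last 4 first.
  - by move=> x _; rewrite lee_fin mulr_ge0.
  - by apply/measurable_EFinP/measurable_funM => //; exact: measurable_indic.
  - by move=> x _; rewrite lee_fin mulr_ge0.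
  - by apply/measurable_EFinP/measurable_funM => //; exact: measurable_indic.
  rewrite !indE// setIid setIidl; last by move=> x [].
  by rewrite lE [X in (_ + _ * X)%E]lebesgue_cube// mulr1 -!EFinM -EFinD.
rewrite lee_fin.
have e1 : C * 4 ^+ n / h m.+1 `^ s * l <= C * 4 ^+ n * (2 ^+ n * n%:R * 2 * g) * g ^+ m.
  apply: (@le_trans _ _ (C * 4 ^+ n / h m.+1 `^ s * (2 ^+ n * n%:R * h m))).
    by rewrite ler_wpM2l// !mulr_ge0 ?exprn_ge0// invr_ge0 powR_ge0.
  rewrite hE (_ : _ * (_ * (2 * _)) = C * 4 ^+ n * (2 ^+ n * n%:R * 2) *
    (h m.+1 / h m.+1 `^ s)); last by ring.
  by rewrite hg exprS le_eqVlt; apply/orP; left; apply/eqP; ring.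
by rewrite [X in _ <= _ + X](_ : _ = C * 4 ^+ n * q ^+ m * 2 ^+ n) ?lerD2r//; ring.
Qed.

End interaction_cube.

(** * Centering *)

Section centering.
Variables (R : realType) (n : nat).
Local Notation lambda := (@lebesgue_rV R n).
Implicit Types (M X Y : set 'rV[R]_n).

Lemma measurable_coord_lt (i : 'I_n) (c : R) :
  measurable [set x : 'rV[R]_n | x ord0 i < c].
Proof.
rewrite (_ : mkset _ = (fun x : 'rV[R]_n => x ord0 i) @^-1` `]-oo, c[).
  by rewrite -[X in measurable X]setTI; exact: (measurable_coord i).
by apply/seteqP; split => x /=; rewrite in_itv/=.
Qed.

Lemma measurable_coord_gt (i : 'I_n) (c : R) :
  measurable [set x : 'rV[R]_n | c < x ord0 i].
Proof.
rewrite (_ : mkset _ = (fun x : 'rV[R]_n => x ord0 i) @^-1` `]c, +oo[).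
  by rewrite -[X in measurable X]setTI; exact: (measurable_coord i).
by apply/seteqP; split => x /=; rewrite in_itv/= andbT.
Qed.

Lemma lebesgue_bounded_lty M (C : R) : measurable M -> 0 <= C ->
  (forall x, M x -> `|x| <= C) -> (lambda M < +oo)%E.
Proof.
move=> mM C0 MC.
apply: (@le_lt_trans _ _ (lambda (cube C))).
  apply: le_measure; rewrite ?inE//; first exact: measurable_cube.
  by move=> x Mx; apply/cube_norm => //; exact: MC.
by rewrite [ltLHS]lebesgue_cube// ltry.
Qed.

(** The slab of [M] fits in a box of side [c' - c] in direction [i] and [2 * C] in the others. *)
Lemma lebesgue_slab M (C : R) (i : 'I_n) (c c' : R) : measurable M -> 0 <= C ->
  (forall x, M x -> `|x| <= C) -> c <= c' ->
  (lambda (M `&` [set x : 'rV[R]_n | (c <= x ord0 i <= c')%R]) <=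
   ((c' - c) * (2 * C) ^+ n.-1)%:E)%E.
Proof.
move=> mM C0 MC cc'.
pose a : 'rV[R]_n := \row_j (if j == i then c else - C).
pose b : 'rV[R]_n := \row_j (if j == i then c' else C).
have E : lambda [set v : 'rV[R]_n | forall j, a ord0 j <= v ord0 j <= b ord0 j] =
    ((c' - c) * (2 * C) ^+ n.-1)%:E.
  rewrite lebesgue_rV_box => [|j]; last by rewrite !mxE; case: eqP => // _; lra.
  congr EFin; rewrite (bigD1 i)//= !mxE eqxx; congr (_ * _).
  rewrite (eq_bigr (fun=> 2 * C)) => [|j ji].
    by rewrite prodr_const cardC1 card_ord.
  by rewrite !mxE (negbTE ji); lra.
rewrite -E; apply: le_measure; rewrite ?inE//.
- apply: measurableI => //.
  rewrite (_ : mkset _ = (fun x : 'rV[R]_n => x ord0 i) @^-1` `[c, c']).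
    by rewrite -[X in measurable X]setTI; exact: (measurable_coord i).
  by apply/seteqP; split => x /=; rewrite in_itv/=.
- exact: measurable_box.
move=> x [Mx xc] j; rewrite !mxE; case: eqP => [->//|_].
by have /(cube_norm _ C0) := MC _ Mx; exact.
Qed.

(** Almost all of [X] lies in [Y], so the intersection already has the full measure of [X], and
    nothing is left for the rest of [Y]. *)
Lemma measure0_setD_swap X Y : measurable X -> measurable Y ->
  (lambda X < +oo)%E -> (lambda Y <= lambda X)%E ->
  lambda (X `\` Y) = 0%E -> lambda (Y `\` X) = 0%E.
Proof.
move=> mX mY Xoo YX XY0.
have Yoo : (lambda Y < +oo)%E by exact: le_lt_trans YX Xoo.
have := measureDI lambda mX mY; rewrite [X in (X + _)%E]XY0 add0e => lX.
have := measureDI lambda mY mX; rewrite setIC -lX => lY.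
move: YX; rewrite lY -[leRHS]add0e leeD2rE ?ge0_fin_numE// => YX.
by apply/eqP; rewrite eq_le YX measure_ge0.
Qed.

Variables (M : set 'rV[R]_n) (C : R).
Hypotheses (mM : measurable M) (C0 : 0 <= C).
Hypothesis MC : forall x, M x -> `|x| <= C.
Variable i : 'I_n.

Let Mp (c : R) := M `&` [set x : 'rV[R]_n | c < x ord0 i].
Let Mm (c : R) := M `&` [set x : 'rV[R]_n | x ord0 i < c].

Let mMp c : measurable (Mp c).
Proof. by apply: measurableI => //; exact: measurable_coord_gt. Qed.
Let mMm c : measurable (Mm c).
Proof. by apply: measurableI => //; exact: measurable_coord_lt. Qed.

Let Moo : (lambda M < +oo)%E. Proof. exact: lebesgue_bounded_lty mM C0 MC. Qed.

Let sub_oo X : measurable X -> X `<=` M -> (lambda X < +oo)%E.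
Proof.
by move=> mX XM; apply: le_lt_trans Moo; apply: le_measure; rewrite ?inE.
Qed.

Let Mpoo c : (lambda (Mp c) < +oo)%E.
Proof. by apply: sub_oo => // x []. Qed.
Let Mmoo c : (lambda (Mm c) < +oo)%E.
Proof. by apply: sub_oo => // x []. Qed.

(** The difference [D] of the measures of the two halves is Lipschitz in [c] and has opposite signs
    beyond the two ends of [M], so the intermediate value theorem applies. *)
Lemma hyperplane_bisection : exists c0, lambda (Mm c0) = lambda (Mp c0).
Proof.
pose D c := fine (lambda (Mm c)) - fine (lambda (Mp c)).
(* Moving the hyperplane affects only the slab in between, but in both halves, hence the factor
   2. *)
pose L := 2 * (2 * C) ^+ n.-1.
have L0 : 0 <= L by rewrite mulr_ge0// exprn_ge0// mulr_ge0.
have DL c c' : c <= c' -> 0 <= D c' - D c <= L * (c' - c).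
  move=> cc'; have sl := @lebesgue_slab M C i c c' mM C0 MC cc'.
  set sla := M `&` _ in sl.
  have msla : measurable sla.
    rewrite /sla (_ : [set x : 'rV[R]_n | c <= x ord0 i <= c'] =
        ~` [set x : 'rV[R]_n | x ord0 i < c] `&` ~` [set x : 'rV[R]_n | c' < x ord0 i]).
      by apply: measurableI => //; apply: measurableI; apply: measurableC;
        [exact: measurable_coord_lt|exact: measurable_coord_gt].
    apply/seteqP; split => x /= => [/andP[h1 h2]|[/negP h1 /negP h2]].
      by split; apply/negP; rewrite -leNgt.
    by rewrite !leNgt h1 h2.
  have lX X Y : measurable X -> measurable Y -> X `<=` M -> Y `<=` M -> X `<=` Y ->
      fine (lambda X) <= fine (lambda Y).
    move=> mX mY XM YM XY; rewrite fine_le ?ge0_fin_numE ?sub_oo//.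
    by apply: le_measure; rewrite ?inE.
  have lU X Y : measurable X -> measurable Y -> X `<=` M -> X `<=` Y `|` sla -> Y `<=` M ->
      fine (lambda X) <= fine (lambda Y) + (c' - c) * (2 * C) ^+ n.-1.
    move=> mX mY XM XY YM.
    have : (lambda X <= lambda Y + ((c' - c) * (2 * C) ^+ n.-1)%:E)%E.
      apply: (@le_trans _ _ (lambda (Y `|` sla))).
        by apply: le_measure; rewrite ?inE//; exact: measurableU.
      apply: (@le_trans _ _ (lambda Y + lambda sla)%E); first exact: measureU2.
      exact: leeD2l.
    rewrite -[lambda X in X in X -> _]fineK ?ge0_fin_numE ?sub_oo//.
    by rewrite -[lambda Y in X in X -> _]fineK ?ge0_fin_numE ?sub_oo// -EFinD lee_fin.
  have := lX (Mm c) (Mm c') (mMm _) (mMm _).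
  have := lX (Mp c') (Mp c) (mMp _) (mMp _).
  have := lU (Mm c') (Mm c) (mMm _) (mMm _).
  have := lU (Mp c) (Mp c') (mMp _) (mMp _).
  have MmM u : Mm u `<=` M by move=> x [].
  have MpM u : Mp u `<=` M by move=> x [].
  have s1 : Mm c `<=` Mm c' by move=> x [? /= h]; split => //; exact: lt_le_trans cc'.
  have s2 : Mp c' `<=` Mp c by move=> x [? /= h]; split => //; exact: le_lt_trans h.
  have s3 : Mm c' `<=` Mm c `|` sla.
    move=> x [? /= h]; have [xc|xc] := ltP (x ord0 i) c; [by left|right].
    by split => //=; rewrite xc ltW.
  have s4 : Mp c `<=` Mp c' `|` sla.
    move=> x [? /= h]; have [xc|xc] := ltP c' (x ord0 i); [by left|right].
    by split => //=; rewrite xc ltW.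
  move=> /(_ (MpM _) s4 (MpM _)) h1 /(_ (MmM _) s3 (MmM _)) h2.
  move=> /(_ (MpM _) (MpM _) s2) h3 /(_ (MmM _) (MmM _) s1) h4.
  by move: h1 h2 h3 h4; rewrite /D /L; lra.
have cD : continuous D.
  move=> x; apply/cvgrPdist_le => e e0; apply/nbhs_ballP.
  (* [L] may vanish, so the modulus of continuity uses [L + 1]. *)
  have L1 : 0 < L + 1 by rewrite ltr_wpDl.
  exists (e / (L + 1)); first by rewrite /= divr_gt0.
  move=> y; rewrite /ball/= ltr_pdivlMr// => xy.
  have [xley|/ltW ylex] := leP x y.
    have /andP[d1 d2] := DL _ _ xley.
    rewrite distrC ger0_norm//; move: xy; rewrite distrC ger0_norm ?subr_ge0//.
    by move: d2 xley; nra.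
  have /andP[d1 d2] := DL _ _ ylex.
  rewrite ger0_norm//; move: xy; rewrite ger0_norm ?subr_ge0//.
  by move: d2 ylex; nra.
have MmC : Mm (- (C + 1)) = set0.
  apply/seteqP; split => // x [/MC /(cube_norm _ C0) /(_ i)] /=; lra.
have MpC : Mp (C + 1) = set0.
  apply/seteqP; split => // x [/MC /(cube_norm _ C0) /(_ i)] /=; lra.
have [] := @IVT R D (- (C + 1)) (C + 1) 0.
- by rewrite -subr_ge0 opprK !addr_ge0.
- exact: continuous_subspaceT.
- rewrite /D MmC MpC measure0/= sub0r subr0.
  have u0 X : 0 <= fine (lambda X) by apply: fine_ge0.
  by rewrite ge_min le_max oppr_le0 !u0 ?orbT.
move=> c _ /eqP; rewrite subr_eq0 => /eqP Dc; exists c.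
by rewrite -[LHS]fineK ?ge0_fin_numE// Dc fineK ?ge0_fin_numE.
Qed.

End centering.

Section symmetric_center.
Variables (R : realType) (n : nat).
Local Notation lambda := (@lebesgue_rV R n).

(** [c0] bisects [M]. Beyond it the outer part is the smaller one. If the alternative says that the
    larger part reflects into the smaller, comparison of measures makes this an equality up to null
    sets, so the smaller part also reflects into the larger. *)
Lemma polarized_center (M : set 'rV[R]_n) (C : R) (i : 'I_n) :
  measurable M -> 0 <= C -> (forall x, M x -> `|x| <= C) ->
  (forall c, lambda [set x | M x /\ c < x ord0 i /\ ~ M (mirror i c x)] = 0%E \/
             lambda [set x | M x /\ x ord0 i < c /\ ~ M (mirror i c x)] = 0%E) ->
  exists c0,
    (forall c, c0 <= c ->
       lambda [set x | M x /\ c < x ord0 i /\ ~ M (mirror i c x)] = 0%E) /\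
    (forall c, c <= c0 ->
       lambda [set x | M x /\ x ord0 i < c /\ ~ M (mirror i c x)] = 0%E).
Proof.
move=> mM C0 MC dich.
pose Mp (c : R) := M `&` [set x : 'rV[R]_n | c < x ord0 i].
pose Mm (c : R) := M `&` [set x : 'rV[R]_n | x ord0 i < c].
have mMp c : measurable (Mp c).
  by apply: measurableI => //; exact: measurable_coord_gt.
have mMm c : measurable (Mm c).
  by apply: measurableI => //; exact: measurable_coord_lt.
have sub_oo X : measurable X -> X `<=` M -> (lambda X < +oo)%E.
  move=> mX XM; apply: le_lt_trans (lebesgue_bounded_lty mM C0 MC).
  by apply: le_measure; rewrite ?inE.
have Mpoo c : (lambda (Mp c) < +oo)%E by apply: sub_oo => // x [].
have Mmoo c : (lambda (Mm c) < +oo)%E by apply: sub_oo => // x [].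
have [c0 Fc0] := hyperplane_bisection mM C0 MC i.
have si c (x : 'rV[R]_n) : mirror i c x ord0 i = 2 * c - x ord0 i.
  by rewrite mirrorE eqxx.
pose sM c := mirror i c @^-1` Mm c; pose sP c := mirror i c @^-1` Mp c.
have msM c : measurable (sM c) by exact: measurable_signed_translation_preimage.
have msP c : measurable (sP c) by exact: measurable_signed_translation_preimage.
have lsM c : lambda (sM c) = lambda (Mm c) by exact: lebesgue_rV_signed_translation.
have lsP c : lambda (sP c) = lambda (Mp c) by exact: lebesgue_rV_signed_translation.
have ApE c : [set x | M x /\ c < x ord0 i /\ ~ M (mirror i c x)] = Mp c `\` sM c.
  apply/seteqP; split => x.
    by move=> [Mx [cx Msx]]; split; [split|move=> -[]].
  move=> [[Mx /= cx] Msx]; split => //; split => // h; apply: Msx; split => //=.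
  by rewrite si; lra.
have AmE c : [set x | M x /\ x ord0 i < c /\ ~ M (mirror i c x)] = Mm c `\` sP c.
  apply/seteqP; split => x.
    by move=> [Mx [cx Msx]]; split; [split|move=> -[]].
  move=> [[Mx /= cx] Msx]; split => //; split => // h; apply: Msx; split => //=.
  by rewrite si; lra.
have swapM c : lambda (Mm c `\` sP c) = lambda (sM c `\` Mp c).
  have mD : measurable (Mm c `\` sP c) by exact: measurableD.
  rewrite -[LHS](lebesgue_rV_signed_translation (fun j => j == i)
    (\row_j (if j == i then 2 * c else 0)) mD).
  congr (lambda _); apply/seteqP.
  by split => x [h1 h2]; split => //; move: h1 h2;
    rewrite /sM /sP /preimage /mkset -/(mirror i c x) mirrorK.
have swapP c : lambda (Mp c `\` sM c) = lambda (sP c `\` Mm c).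
  have mD : measurable (Mp c `\` sM c) by exact: measurableD.
  rewrite -[LHS](lebesgue_rV_signed_translation (fun j => j == i)
    (\row_j (if j == i then 2 * c else 0)) mD).
  congr (lambda _); apply/seteqP.
  by split => x [h1 h2]; split => //; move: h1 h2;
    rewrite /sM /sP /preimage /mkset -/(mirror i c x) mirrorK.
have incr c c' : c <= c' -> (lambda (Mm c) <= lambda (Mm c'))%E.
  move=> cc'; apply: le_measure; rewrite ?inE// => x [Mx /= h].
  by split => //; exact: lt_le_trans cc'.
have decr c c' : c <= c' -> (lambda (Mp c') <= lambda (Mp c))%E.
  move=> cc'; apply: le_measure; rewrite ?inE// => x [Mx /= h].
  by split => //; exact: le_lt_trans h.
exists c0; split => c cc0.
- rewrite ApE; case: (dich c); rewrite ?ApE ?AmE// swapM.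
  apply: measure0_setD_swap => //; first by rewrite lsM.
  rewrite lsM; apply: (le_trans (decr _ _ cc0)).
  by rewrite -[leLHS]Fc0; exact: incr.
- rewrite AmE; case: (dich c); rewrite ?ApE ?AmE// swapP.
  apply: measure0_setD_swap => //; first by rewrite lsP.
  rewrite lsP; apply: (le_trans (incr _ _ cc0)).
  by rewrite [leLHS]Fc0; exact: decr.
Qed.

End symmetric_center.

(** * Almost everywhere monotonicity *)

Section open_box.
Variables (R : realType) (n : nat).

Definition open_box (a : 'I_n -> R) : set 'rV[R]_n :=
  [set y | forall j, `|y ord0 j| < a j].

Lemma open_open_box (a : 'I_n -> R) : open (open_box a).
Proof.
rewrite openE => x xa.
suff : nbhs x [set y : 'rV[R]_n | forall j, `|y ord0 j| < a j] by [].
apply: (@filter_forall _ 'I_n (fun j => [set y : 'rV[R]_n | `|y ord0 j| < a j])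
  (nbhs x) (nbhs_filter x)) => j.
have : (fun y : 'rV[R]_n => `|y ord0 j|) @ x --> `|x ord0 j|.
  by apply: (@cvg_norm _ _ _ (nbhs x) _ (fun y : 'rV[R]_n => y ord0 j));
    exact: (@coord_continuous R 1 n ord0 j x).
by move=> /cvgr_lt; apply; exact: xa.
Qed.

Lemma open_measurable_rV (U : set 'rV[R]_n) : open U -> measurable U.
Proof. by move=> oU; exact: sub_sigma_algebra. Qed.

End open_box.

Section decreasing.
Variables (R : realType) (n : nat).
Local Notation lambda := (@lebesgue_rV R n).
Variables (M : set 'rV[R]_n).
Hypothesis mM : measurable M.
Hypothesis Mpos : forall i c, 0 <= c ->
  lambda.-negligible [set x | M x /\ c < x ord0 i /\ ~ M (mirror i c x)].
Hypothesis Mneg : forall i c, c <= 0 ->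
  lambda.-negligible [set x | M x /\ x ord0 i < c /\ ~ M (mirror i c x)].

Let Msym i : lambda.-negligible [set x | M x /\ ~ M (mirror i 0 x)].
Proof.
apply: negligibleS (negligibleU (Mpos i (lexx 0)) (Mneg i (lexx 0))).
move=> x [Mx Msx]; have [x0|x0|x0] := ltgtP 0 (x ord0 i); [by left|by right|].
exfalso; apply: Msx; rewrite (_ : mirror _ _ _ = x)//.
by apply/rowP => j; rewrite mirrorE; case: eqP => // ->; rewrite -x0; ring.
Qed.

(* The composition of the two mirrors is the translation by [- z] along the
   [i]-th axis. *)
Let bad1 i (z : R) : lambda.-negligible [set x | M x /\
  `|x ord0 i - z| < `|x ord0 i| /\ ~ M (mirror i 0 (mirror i (z / 2) x))].
Proof.
have sub : lambda.-negligible
    (mirror i (z / 2) @^-1` [set x | M x /\ ~ M (mirror i 0 x)]).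
  exact: negligible_signed_translation.
have [z0|z0|->] := ltgtP z 0.
(* For [z < 0], being closer to [z] than to 0 means [x_i < z / 2], so the first mirror keeps almost
   every such [x] in [M]; the set in [sub] accounts for the second mirror. *)
- have zz : z / 2 <= 0 by lra.
  apply: negligibleS (negligibleU (Mneg i zz) sub).
  move=> x [Mx [xz Ms]]; have [h|h] := pselect (M (mirror i (z / 2) x)).
    by right.
  left; split => //; split => //; rewrite ltNge; apply/negP => zx.
  by move: xz; case: (ler0P (x ord0 i)); case: (ler0P (x ord0 i - z)); lra.
- have zz : 0 <= z / 2 by lra.
  apply: negligibleS (negligibleU (Mpos i zz) sub).
  move=> x [Mx [xz Ms]]; have [h|h] := pselect (M (mirror i (z / 2) x)).
    by right.
  left; split => //; split => //; rewrite ltNge; apply/negP => zx.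
  by move: xz; case: (ler0P (x ord0 i)); case: (ler0P (x ord0 i - z)); lra.
- by apply: negligibleS (@negligible_set0 _ _ _ lambda) => x [_ []]; rewrite subr0 ltxx.
Qed.

(** The translation is carried out one axis at a time: [T k] moves the first [k] coordinates. It
    leaves coordinate [k] alone, so [bad1] applies to [T k x] in that direction. *)
Let badz (z : 'rV[R]_n) : lambda.-negligible [set x | M x /\
  (forall j, `|x ord0 j - z ord0 j| < `|x ord0 j|) /\ ~ M (x - z)].
Proof.
pose zk k : 'rV[R]_n := \row_j (if (j < k)%N then - z ord0 j else 0).
pose T k := signed_translation (fun=> false) (zk k).
have TE k x j : T k x ord0 j =
    if (j < k)%N then x ord0 j - z ord0 j else x ord0 j.
  by rewrite !mxE expr0 mul1r; case: ifP; rewrite ?addr0.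
suff h k : (k <= n)%N -> lambda.-negligible [set x | M x /\
    (forall j, `|x ord0 j - z ord0 j| < `|x ord0 j|) /\ ~ M (T k x)].
  have := h n (leqnn n); congr (_.-negligible _); apply/funext => x /=.
  by rewrite (_ : T n x = x - z)//; apply/rowP => j; rewrite TE ltn_ord !mxE.
elim: k => [_|k ih kn].
  apply: negligibleS (@negligible_set0 _ _ _ lambda) => x [Mx [_]]; apply.
  by rewrite (_ : T 0%N x = x)//; apply/rowP => j; rewrite TE.
have sub := negligible_signed_translation (fun=> false) (zk k)
  (bad1 (Ordinal kn) (z ord0 (Ordinal kn))).
apply: negligibleS (negligibleU (ih (ltnW kn)) sub) => x [Mx [xz Ms]].
have [h|h] := pselect (M (T k x)); last by left.
right; split => //; split.
  by rewrite -/(T k x) TE/= ltnn.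
rewrite -/(T k x) (_ : mirror _ _ _ = T k.+1 x)//.
apply/rowP => j; rewrite !mirrorE !TE ltnS -(inj_eq val_inj)/=.
have [jk|jk|jk] := ltngtP j k => //.
have -> : j = Ordinal kn by exact: val_inj.
by field.
Qed.

(** By [badz] the set [N] of bad pairs has null sections at every [z]. Tonelli's theorem makes
    almost all of its sections at [x] null, and [z |-> x - z] carries such a section to the part of
    the box outside [M]. *)
Lemma ae_orthant_box : exists Z, [/\ measurable Z, lambda Z = 0%E &
  forall x, M x -> ~ Z x ->
    lambda (open_box (fun j => `|x ord0 j|) `\` M) = 0%E].
Proof.
pose N : set ('rV[R]_n * 'rV[R]_n) := [set p : 'rV[R]_n * 'rV[R]_n | M p.1 /\
  (forall j, `|p.1 ord0 j - p.2 ord0 j| < `|p.1 ord0 j|) /\ ~ M (p.1 - p.2)].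
have mfst j : measurable_fun setT (fun p : 'rV[R]_n * 'rV[R]_n => p.1 ord0 j).
  exact: (measurableT_comp (measurable_coord j) measurable_fst).
have msnd j : measurable_fun setT (fun p : 'rV[R]_n * 'rV[R]_n => p.2 ord0 j).
  exact: (measurableT_comp (measurable_coord j) measurable_snd).
have mN : measurable N.
  rewrite (_ : N = fst @^-1` M `&`
      (\bigcap_(j : 'I_n) ((fun p : 'rV[R]_n * 'rV[R]_n =>
         `|p.1 ord0 j - p.2 ord0 j| < `|p.1 ord0 j|) @^-1` [set true])) `&`
      ~` ((fun p : 'rV[R]_n * 'rV[R]_n => p.1 - p.2) @^-1` M)); last first.
    apply/seteqP; split => p.
      by move=> [h1 [h2 h3]]; split => //; split => // j _; exact: h2.
    by move=> [[h1 h2] h3]; split => //; split => // j; exact: h2.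
  apply: measurableI; first apply: measurableI.
  - by rewrite -[X in measurable X]setTI; exact: measurable_fst.
  - apply: fin_bigcap_measurable => [|j _]; first exact: finite_finset.
    rewrite -[X in measurable X]setTI.
    have : measurable_fun setT (fun p : 'rV[R]_n * 'rV[R]_n =>
        `|p.1 ord0 j - p.2 ord0 j| < `|p.1 ord0 j|).
      apply: measurable_fun_ltr.
        apply: (measurableT_comp (@normr_measurable R setT)).
        exact: measurable_funB.
      exact: (measurableT_comp (@normr_measurable R setT)).
    by apply.
  - apply: measurableC; rewrite -[X in measurable X]setTI.
    exact: measurable_subr_rV.
have lN z : lambda (ysection N z) = 0%E.
  apply/negligibleP; first exact: measurable_ysection.
  apply: negligibleS (badz z) => x; rewrite /ysection /= inE => -[h1 [h2 h3]].
  by split.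
have : (\int[lambda]_x lambda (xsection N x) = 0)%E.
  have := indic_fubini_tonelli lambda lambda mN.
  rewrite (indic_fubini_tonelli_FE lambda mN) (indic_fubini_tonelli_GE lambda mN).
  move=> ->; rewrite integral0_eq// => z _.
  exact: lN.
have mF : measurable_fun setT (fun x => lambda (xsection N x)).
  exact: measurable_fun_xsection.
move=> intN.
have /(ae_eq_integral_abs lambda measurableT mF) :
    (\int[lambda]_x `|lambda (xsection N x)| = 0)%E.
  by rewrite -[RHS]intN; apply: eq_integral => x _; rewrite gee0_abs.
move=> [Z [mZ Z0 hZ]]; exists Z; split => // x Mx nZx.
have : lambda (xsection N x) = 0%E.
  by apply: contrapT => h; apply: nZx; apply: hZ => /(_ I).
set B := (X in lambda X = _ -> _) => lB.
have mB : measurable B by exact: measurable_xsection.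
have E : B = signed_translation (fun=> true) x @^-1`
    (open_box (fun j => `|x ord0 j|) `\` M).
  have TE z : signed_translation (fun=> true) x z = x - z.
    by apply/rowP => j; rewrite !mxE expr1; ring.
  apply/seteqP; split => z.
    rewrite /B /xsection /= inE => -[h1 [h2 h3]].
    split; rewrite TE// => j; have := h2 j; rewrite !mxE//.
  move=> [] /=; rewrite TE => h2 h3; rewrite /B /xsection /= inE.
  split => //; split => // j.
  by have := h2 j; rewrite !mxE.
rewrite -lB E; apply/esym/lebesgue_rV_signed_translation.
by apply: measurableD; [apply: open_measurable_rV; exact: open_open_box|exact: mM].
Qed.

End decreasing.

Lemma negligible_bigcup_countType d (T : measurableType d) (R : realType)
    (mu : {measure set T -> \bar R}) (I : countType) (F : I -> set T) :
  (forall i, mu.-negligible (F i)) -> mu.-negligible (\bigcup_i F i).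
Proof.
move=> negF.
apply: (@negligibleS _ _ _ _ (\bigcup_k
    (if unpickle k is Some i then F i else set0))).
  by move=> x [i _ Fx]; exists (pickle i) => //; rewrite pickleK.
apply: negligible_bigcup => k; case: unpickle => [i|];
  [exact: negF|exact: negligible_set0].
Qed.

(** * Null antichains for strict coordinatewise domination *)

Section antichain.
Variables (R : realType) (n : nat).
Local Notation lambda := (@lebesgue_rV R n).

(** Translates of [N] along the diagonal [e] of the orthant are disjoint: a common point would give
    two points of [N], one strictly dominating the other. Infinitely many translates of equal
    measure fit in one cube, so the measure is 0. *)
Lemma lebesgue_antichain_orthant (N : set 'rV[R]_n) (C : R) (b : 'I_n -> bool) :
  measurable N -> 0 <= C -> (forall x, N x -> `|x| <= C) ->
  (forall x j, N x -> 0 < (-1) ^+ b j * x ord0 j) ->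
  (forall x y, N x -> N y -> ~ (forall j, `|x ord0 j| < `|y ord0 j|)) ->
  lambda N = 0%E.
Proof.
move=> mN C0 NC Npos Nanti.
(* Distinct shifts in []0, 1]], which keep every translate in the cube of radius [C + 1]. *)
pose q k : R := k.+1%:R^-1.
have q01 k : 0 < q k <= 1 by rewrite invr_gt0 ltr0n/= invf_le1// ler1n.
pose e : 'rV[R]_n := \row_j (-1) ^+ b j.
have ee j : e ord0 j * e ord0 j = 1 by rewrite !mxE -expr2 sqrr_sign.
pose F k := signed_translation (fun=> false) (- (q k *: e)) @^-1` N.
have FE k y j : signed_translation (fun=> false) (- (q k *: e)) y ord0 j =
    y ord0 j - q k * e ord0 j by rewrite !mxE expr0 mul1r.
have mF k : measurable (F k) by exact: measurable_signed_translation_preimage.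
have lF k : lambda (F k) = lambda N by exact: lebesgue_rV_signed_translation.
have disj k l y : (k < l)%N -> F k y -> F l y -> False.
  move=> kl Fk Fl; apply: (Nanti _ _ Fk Fl) => j.
  have qkl : q l < q k by rewrite /q ltf_pV2 ?posrE ?ltr0n// ltr_nat.
  have := Npos _ j Fk; have := Npos _ j Fl; rewrite !FE.
  have ej : `|e ord0 j| = 1 by rewrite mxE normr_sign.
  have E (u : R) : `|u| = `|(-1) ^+ b j * u| by rewrite normrM normr_sign mul1r.
  move=> hl hk; rewrite [X in X < _]E [X in _ < X]E (gtr0_norm hl) (gtr0_norm hk).
  have := ee j; rewrite !mxE => ejj; rewrite !mulrBr !(mulrCA _ (q _)) ejj; lra.
have tF : trivIset setT F.
  apply/trivIsetP => k l _ _ kl; apply/seteqP; split => // y [Fk Fl].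
  by move: kl; rewrite neq_ltn => /orP[] kl; [exact: (disj k l y)|exact: (disj l k y)].
have [r lr] : exists r : R, lambda N = r%:E.
  exists (fine (lambda N)); rewrite fineK// ge0_fin_numE//.
  exact: lebesgue_bounded_lty mN C0 NC.
have r0 : 0 <= r by rewrite -lee_fin -lr.
have C10 : 0 <= C + 1 by rewrite addr_ge0.
have sumF m : m%:R * r <= (2 * (C + 1)) ^+ n.
  have mU : measurable (\big[setU/set0]_(i < m) F i).
    by apply: bigsetU_measurable => i _; exact: mF.
  rewrite -lee_fin; have <- := @lebesgue_cube R n _ C10.
  have <- : lambda (\big[setU/set0]_(i < m) F i) = (m%:R * r)%:E.
    rewrite [LHS](@measure_semi_additive_ord _ _ _ lambda m F (fun k => mF k) _ mU); last first.
      by apply/trivIsetP => k l _ _ kl; move/trivIsetP : tF; apply.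
    rewrite (eq_bigr (fun=> r%:E)) => [|i _]; last exact: etrans (lF i) lr.
    by rewrite sumEFin sumr_const card_ord mulr_natl.
  apply: le_measure; rewrite ?inE//; first exact: measurable_cube.
  rewrite -bigcup_mkord => y [k _ Fy]; apply/cube_norm => //.
  have ne : `|q k *: e| <= 1.
    rewrite normrZ gtr0_norm ?(andP (q01 k)).1//.
    apply: (@le_trans _ _ (q k * 1)); last by rewrite mulr1 (andP (q01 k)).2.
    rewrite ler_pM2l ?(andP (q01 k)).1//; apply/cube_norm => // j.
    by rewrite -ler_norml mxE normr_sign.
  have := NC _ Fy; set y' := signed_translation _ _ _.
  have -> : y = y' + q k *: e.
    by apply/rowP => j; rewrite mxE FE [(q k *: e) _ _]mxE subrK.
  by move=> ?; apply: (le_trans (ler_normD _ _)); exact: lerD.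
rewrite lr; congr EFin; apply/eqP; rewrite eq_le r0 andbT leNgt; apply/negP => rpos.
have B0 : 0 <= (2 * (C + 1)) ^+ n / r by rewrite divr_ge0// exprn_ge0// mulr_ge0.
have := archi_boundP B0; rewrite ltr_pdivrMr// ltNge; apply/negP.
by rewrite negbK; exact: sumF.
Qed.

(** The signs of the coordinates, none of which is zero, split [N] into finitely many pieces, one in
    each open orthant. *)
Lemma lebesgue_antichain (N : set 'rV[R]_n) (C : R) :
  measurable N -> 0 <= C -> (forall x, N x -> `|x| <= C) ->
  (forall x j, N x -> x ord0 j != 0) ->
  (forall x y, N x -> N y -> ~ (forall j, `|x ord0 j| < `|y ord0 j|)) ->
  lambda.-negligible N.
Proof.
move=> mN C0 NC Nneq Nanti.
pose P (b : {ffun 'I_n -> bool}) : set 'rV[R]_n := N `&`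
  \bigcap_(j : 'I_n) [set x : 'rV[R]_n |
    0 < signed_translation b 0 x ord0 j].
have PE (b : {ffun 'I_n -> bool}) (x : 'rV[R]_n) j :
    signed_translation b 0 x ord0 j = (-1) ^+ b j * x ord0 j.
  by rewrite !mxE addr0.
have mP b : measurable (P b).
  apply: measurableI => //; apply: fin_bigcap_measurable => [|j _].
    exact: finite_finset.
  exact: (measurable_signed_translation_preimage b 0 (measurable_coord_gt j 0)).
apply: negligibleS (@negligible_bigcup_countType _ _ _ lambda _ P _).
  move=> x Nx; exists [ffun j => x ord0 j < 0] => //; split => // j _ /=.
  rewrite PE ffunE mulr_sign; case: (ltP (x ord0 j) 0) => x0; first by rewrite oppr_gt0.
  by rewrite lt_neqAle eq_sym x0 Nneq.
move=> b; apply/negligibleP; first exact: mP.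
apply: (@lebesgue_antichain_orthant _ C b) => //.
- by move=> x [/NC].
- by move=> x j [_ /(_ j I)] /=; rewrite PE.
- by move=> x y [Nx _] [Ny _]; exact: Nanti.
Qed.

End antichain.

(** * The hull by boxes *)

Section hull.
Variables (R : realType) (n : nat).
Local Notation lambda := (@lebesgue_rV R n).
Variables (M : set 'rV[R]_n) (C : R) (Z : set 'rV[R]_n).
Hypotheses (mM : measurable M) (C0 : 0 <= C) (MC : forall x, M x -> `|x| <= C).
Hypotheses (mZ : measurable Z) (Z0 : lambda Z = 0%E).
Hypothesis MZ : forall x, M x -> ~ Z x ->
  lambda (open_box (fun j => `|x ord0 j|) `\` M) = 0%E.

(* The bound [a j <= C] loses nothing when [M] has radius [C], and it makes the
   hull bounded by construction. *)
Definition box_hull : set 'rV[R]_n := [set x | exists a : 'I_n -> R,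
  [/\ forall j, a j <= C, lambda (open_box a `\` M) = 0%E & open_box a x]].

Let mB (a : 'I_n -> R) : measurable (open_box a `\` M).
Proof.
apply: measurableD; last exact: mM.
by apply: open_measurable_rV; exact: open_open_box.
Qed.

Lemma open_box_hull : open box_hull.
Proof.
rewrite (_ : box_hull = \bigcup_(a in [set a : 'I_n -> R |
    (forall j, a j <= C) /\ lambda (open_box a `\` M) = 0%E]) open_box a).
  by apply: bigcup_open => a _; exact: open_open_box.
apply/seteqP; split => x; first by move=> [a [h1 h2 h3]]; exists a.
by move=> [a [h1 h2] h3]; exists a.
Qed.

Lemma box_hull_norm x : box_hull x -> `|x| <= C.
Proof.
move=> [a [aC _ xa]]; apply/cube_norm => // j; rewrite -ler_norml.
by apply: le_trans (aC j); exact/ltW/xa.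
Qed.

(** Unconditionality, star-shapedness and the continuity of the radial function all rest on this
    monotonicity. *)
Lemma box_hull_anti (x y : 'rV[R]_n) : box_hull x ->
  (forall j, `|y ord0 j| <= `|x ord0 j|) -> box_hull y.
Proof.
move=> [a [aC la xa]] yx; exists a; split => // j.
by apply: le_lt_trans (yx j) _; exact: xa.
Qed.

(** Between a point and the sides of a box containing it there is a box with rational sides, still
    almost contained in [M]; there are only countably many of these. *)
Lemma box_hull_sub : lambda.-negligible (box_hull `\` M).
Proof.
pose F (q : {ffun 'I_n -> rat}) : set 'rV[R]_n :=
  if `[< lambda (open_box (fun j => ratr (q j)) `\` M) = 0%E >]
  then open_box (fun j => ratr (q j)) `\` M else set0.
apply: negligibleS (@negligible_bigcup_countType _ _ _ lambda _ F _).
  move=> x [[a [aC la xa]] nMx].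
  have rq j : exists q : rat, `|x ord0 j| < ratr q < a j.
    have /rat_in_itvoo[q qx] := xa j.
    by exists q; move: qx; rewrite in_itv.
  have [q qx] := choice rq.
  exists [ffun j => q j] => //.
  rewrite /F asboolT; first by split => // j; rewrite ffunE; case/andP: (qx j).
  apply: (subset_measure0 (mB _) (mB _) _ la).
  move=> y [yq nMy]; split => // j; apply: lt_trans (yq j) _.
  by rewrite ffunE; case/andP: (qx j).
move=> q; rewrite /F; case: asboolP => h; last exact: negligible_set0.
by apply/negligibleP; first exact: mB.
Qed.

(** Off [Z] and the coordinate hyperplanes the remainder is an antichain: a point strictly dominated
    by [y] lies in the open box of [y], which is almost contained in [M], and hence in the hull. *)
Lemma sub_box_hull : lambda.-negligible (M `\` box_hull).
Proof.
(* The hyperplane is written as a slab of width zero, so that [lebesgue_slab] shows it to be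
   null. *)
pose Hj (j : 'I_n) : set 'rV[R]_n := M `&` [set x : 'rV[R]_n | 0 <= x ord0 j <= 0].
have negH : lambda.-negligible (\bigcup_j Hj j).
  apply: negligible_bigcup_countType => j.
  have mH : measurable (Hj j).
    apply: measurableI => //.
    rewrite (_ : mkset _ = (fun x : 'rV[R]_n => x ord0 j) @^-1` `[0, 0]).
      by rewrite -[X in measurable X]setTI; exact: (measurable_coord j).
    by apply/seteqP; split => x /=; rewrite in_itv/=.
  apply/negligibleP => //; apply/eqP; rewrite eq_le measure_ge0 andbT.
  by have := lebesgue_slab j mM C0 MC (lexx 0); rewrite subrr mul0r.
pose N := M `\` box_hull `\` Z `\` \bigcup_j [set x : 'rV[R]_n | x ord0 j = 0].
have mU : measurable box_hull by apply: open_measurable_rV; exact: open_box_hull.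
have mN : measurable N.
  apply: measurableD; first by apply: measurableD => //; exact: measurableD.
  rewrite -[X in measurable X]setCK setC_bigcup; apply: measurableC.
  apply: fin_bigcap_measurable => [|j _]; first exact: finite_finset.
  apply: measurableC.
  rewrite (_ : mkset _ = (fun x : 'rV[R]_n => x ord0 j) @^-1` [set 0]) //.
  by rewrite -[X in measurable X]setTI; exact: (measurable_coord j).
have negN : lambda.-negligible N.
  apply: (lebesgue_antichain mN C0).
  - by move=> x [[[/MC]]].
  - by move=> x j [_ h]; apply/eqP => xj; apply: h; exists j.
  - move=> x y [[[Mx Ux] Zx] _] [[[My Uy] Zy] _] xy; apply: Ux.
    exists (fun j => `|y ord0 j|); split => //; last exact: MZ.
    by move=> j; rewrite ler_norml; have /(cube_norm _ C0) := MC My; exact.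
have negZ : lambda.-negligible Z by apply/negligibleP.
apply: negligibleS (negligibleU negN (negligibleU negZ negH)) => x [Mx Ux].
have [Zx|Zx] := pselect (Z x); first by right; left.
have [[j _ /= xj]|xj] := pselect ((\bigcup_j [set x : 'rV[R]_n | x ord0 j = 0]) x).
  by right; right; exists j => //; split => //=; rewrite xj lexx.
by left.
Qed.

Lemma box_hull_unconditional : unconditional box_hull.
Proof.
have rU i x : box_hull x -> box_hull (reflection i x).
  move=> Ux; apply: (box_hull_anti Ux) => j; rewrite mxE.
  by case: eqP; rewrite ?normrN.
move=> i; apply/seteqP; split => [_ [x Ux <-]|x Ux]; first exact: rU.
exists (reflection i x); first exact: rU.
by apply/rowP => j; rewrite !mxE; case: eqP; rewrite ?opprK.
Qed.

Lemma box_hull_star_shaped : star_shaped box_hull.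
Proof.
move=> x l Ux /andP[l0 l1]; apply: (box_hull_anti Ux) => j.
by rewrite mxE normrM ger0_norm// ler_piMl.
Qed.

Lemma box_hull_bounded : bounded_set box_hull.
Proof.
exists C; split; first exact: num_real.
by move=> y Cy x /box_hull_norm /le_trans; apply; exact: ltW.
Qed.

(** An empty hull would make all of [M] negligible; a nonempty one contains the origin by
    monotonicity and is open. *)
Lemma box_hull_interior0 : lambda M <> 0%E -> box_hull^° 0.
Proof.
move=> M0; have [[x Ux]|U0] := pselect (box_hull !=set0).
  have : box_hull 0 by apply: (box_hull_anti Ux) => j; rewrite mxE normr0.
  by have := open_box_hull; rewrite openE; apply.
exfalso; apply: M0; apply/negligibleP => //.
apply: negligibleS sub_box_hull => x Mx; split => // Ux; apply: U0.
by exists x.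
Qed.

End hull.

(** * Continuity of the radial function *)

Section radial.
Variables (R : realType) (n : nat).
Variables (L : set 'rV[R]_n) (C : R).
Hypotheses (oL : open L) (L0 : L 0) (LC : forall x, L x -> `|x| <= C).
Hypothesis Lanti : forall x y : 'rV[R]_n, L x ->
  (forall j, `|y ord0 j| <= `|x ord0 j|) -> L y.

Lemma radial_has_sup (x : 'rV[R]_n) : x != 0 ->
  has_sup [set l : R | 0 <= l /\ L (l *: x)].
Proof.
move=> x0; split; first by exists 0 => /=; rewrite scale0r.
exists (C / `|x|) => l /= [l0 Llx].
by rewrite ler_pdivlMr ?normr_gt0//; have := LC Llx; rewrite normrZ ger0_norm.
Qed.

(** Openness gives the lower bound: if [l *: x] is in [L], so is [l *: y] for [y] near [x].
    Monotonicity gives the upper bound: a much longer multiple of [y] in [L] would dominate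
    [r' *: x], which is too long to be in [L]. *)
Lemma radial_continuous :
  {within [set x : 'rV[R]_n | x != 0], continuous (radial_function L)}.
Proof.
have o0 : open [set x : 'rV[R]_n | x != 0].
  rewrite (_ : mkset _ = ~` [set 0]); last first.
    by apply/seteqP; split => x /= /eqP.
  apply: closed_openC; apply: compact_closed; first exact: norm_hausdorff.
  exact: compact_set1.
rewrite continuous_open_subspace// => x /set_mem x0.
have {}x0 : x != 0 := x0.
apply/(@cvgrPdist_le _ _ _ (nbhs x) (nbhs_filter x)) => e e0.
have rx0 : 0 <= radial_function L x.
  by apply: ub_le_sup; [exact: (radial_has_sup x0).2|rewrite /= scale0r].
have [l [l0 Ll] rl] := sup_adherent e0 (radial_has_sup x0).
have near1 : \forall y \near x, L (l *: y).
  have := @scaler_continuous _ _ l x.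
  by move=> /(_ L); apply; exact: open_nbhs_nbhs.
pose r' := radial_function L x + e / 2; pose r := radial_function L x + e.
have r'0 : 0 < r' by rewrite ltr_wpDl// divr_gt0.
have r'r : r' < r by rewrite /r' /r; lra.
have near2 : \forall y \near x, forall j, `|r' * x ord0 j| <= `|r * (y : 'rV[R]_n) ord0 j|.
  apply: (@filter_forall _ 'I_n (fun j => [set y : 'rV[R]_n |
    `|r' * x ord0 j| <= `|r * y ord0 j|]) (nbhs x) (nbhs_filter x)) => j.
  (* A vanishing coordinate of [x] imposes nothing on [y]; at the others, [r' < r] leaves room for a
     small perturbation. *)
  have [xj|xj] := eqVneq (x ord0 j) 0.
    by apply: nearW => y /=; rewrite xj mulr0 normr0.
  have r0 : 0 < r by exact: lt_trans r'r.
  have : (fun y : 'rV[R]_n => `|y ord0 j|) @ x --> `|x ord0 j|.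
    apply: (@cvg_norm _ _ _ (nbhs x) _ (fun y : 'rV[R]_n => y ord0 j)).
    exact: (@coord_continuous R 1 n ord0 j x).
  move=> /cvgr_ge /(_ (r' / r * `|x ord0 j|)) h.
  have {}h := h ltac:(by rewrite gtr_pMl ?normr_gt0// ltr_pdivrMr// mul1r).
  apply: filterS h => y; rewrite /= mulrAC ler_pdivrMr// [leRHS]mulrC => h.
  by rewrite !normrM (gtr0_norm r'0) (gtr0_norm r0).
near=> y.
have y0 : y != 0 by near: y; exact: open_nbhs_nbhs.
have Lly : L (l *: y) by near: y.
have xy : forall j, `|r' * x ord0 j| <= `|r * y ord0 j| by near: y.
have ly : l <= radial_function L y.
  by apply: ub_le_sup; [exact: (radial_has_sup y0).2|split].
have yr : radial_function L y <= r.
  apply: ge_sup; first exact: (radial_has_sup y0).1.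
  move=> t /= [t0 Lt]; rewrite leNgt; apply/negP => rt.
  have : L (r' *: x).
    apply: (Lanti Lt) => j; rewrite !mxE; apply: (le_trans (xy j)).
    rewrite !normrM ler_wpM2r// !ger0_norm// ?ltW//.
    exact: lt_trans r'r.
  move=> Lr'; have : r' <= radial_function L x.
    by apply: ub_le_sup; [exact: (radial_has_sup x0).2|split => //; exact: ltW].
  by rewrite /r'; lra.
move: rl ly yr; rewrite -/(radial_function L x) /r => rl ly yr.
by rewrite ler_norml; lra.
Unshelve. all: by end_near. Qed.

End radial.

(** * Minimizers *)

Section minimizer.
Variables (R : realType) (n : nat) (s : R) (K : set 'rV[R]_n).
Hypotheses (s01 : 0 < s < 1).
Hypotheses (uK : unconditional K) (sK : strictly_convex_body K).
Local Notation lambda := (@lebesgue_rV R n).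

Definition perimeter_kernel (z : 'rV[R]_n) : R :=
  (gauge_norm K z `^ (n%:R + s))^-1.
Local Notation k := perimeter_kernel.

Let ns0 : 0 < n%:R + s.
Proof. by rewrite ltr_wpDl//; case/andP: s01. Qed.

Lemma measurable_perimeter_kernel : measurable_fun setT k.
Proof.
rewrite (_ : k = (@powR R ^~ (- (n%:R + s))) \o gauge_norm K).
  exact: (measurableT_comp (measurable_powR _) (measurable_gauge_norm uK sK)).
by apply/funext => z /=; rewrite powRN.
Qed.

Lemma perimeter_kernel_ge0 z : 0 <= k z.
Proof. by rewrite invr_ge0 powR_ge0. Qed.

Lemma perimeter_kernel_reflection i z : k (reflection i z) = k z.
Proof. by rewrite /k gauge_norm_reflection. Qed.

Lemma perimeter_kernel_lt i (x y : 'rV[R]_n) : x != 0 ->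
  `|x ord0 i| < `|y ord0 i| ->
  (forall j, j != i -> x ord0 j = y ord0 j) -> k y < k x.
Proof.
move=> x0 xy xyj; have gx : 0 < gauge_norm K x by rewrite gauge_norm_gt0.
have gxy := gauge_norm_lt uK sK xy xyj.
rewrite ltf_pV2 ?posrE ?powR_gt0//; last exact: lt_trans gxy.
by apply: gt0_ltr_powR; rewrite ?nnegrE// ltW//; exact: lt_trans gxy.
Qed.

Lemma perimeter_kernel_le : exists2 C, 0 <= C &
  forall z, z != 0 -> k z <= C * (`|z| `^ (n%:R + s))^-1.
Proof.
have [c c0 cK] := gauge_norm_ge_norm uK sK.
exists (c `^ (n%:R + s))^-1; first by rewrite invr_ge0 powR_ge0.
move=> z z0; have z0' : 0 < `|z| by rewrite normr_gt0.
rewrite -invfM -powRM//; last exact: ltW.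
have cz : 0 < c * `|z| by rewrite mulr_gt0.
rewrite lef_pV2 ?posrE ?powR_gt0//; last by rewrite gauge_norm_gt0.
by apply: ge0_ler_powR; rewrite ?nnegrE ?(ltW ns0) ?(ltW cz) ?gauge_norm_ge0.
Qed.

Variable M : set 'rV[R]_n.
Hypothesis minM : isoperimetric_minimizer s K M.

Let mM : measurable M. Proof. by case: minM => -[]. Qed.
Let M0 : (0 < lambda M)%E. Proof. by case: minM. Qed.

Lemma minimizer_bounded : exists2 C : R, 0 < C & forall x, M x -> `|x| <= C.
Proof. by case: minM => -[bM _] _ _; exact: bounded_set_norm_le. Qed.

Let ratioE E (r : R) : lambda E = r%:E ->
  isoperimetric_ratio s K E =
  (interaction k E (~` E) * (r `^ (- ((n%:R - s) / n%:R)))%:E)%E.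
Proof. by move=> Er; rewrite /isoperimetric_ratio Er poweR_EFin. Qed.

Let lamM : exists2 r : R, 0 < r & lambda M = r%:E.
Proof.
have [C C0 MC] := minimizer_bounded.
have Moo := lebesgue_bounded_lty mM (ltW C0) MC.
exists (fine (lambda M)); first by rewrite fine_gt0// M0.
by rewrite fineK// ge0_fin_numE.
Qed.

Lemma minimizer_le E : bounded_borel E -> (0 < lambda E)%E ->
  (isoperimetric_ratio s K M <= isoperimetric_ratio s K E)%E.
Proof.
move=> bE E0; case: minM => _ _ ->; apply: ereal_inf_lbound.
by exists E.
Qed.

(** The cube of side 2 is a competitor of finite ratio, so the ratio of [M] is finite. Without this,
    equal infinite perimeters would say nothing about the pieces. *)
Lemma minimizer_interaction_lty : (interaction k M (~` M) < +oo)%E.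
Proof.
have [r r0 lM] := lamM.
have [C C0 kC] := perimeter_kernel_le.
have Qoo := interaction_cube_lty measurable_perimeter_kernel
  perimeter_kernel_ge0 s01 C0 kC.
have lQ : lambda (cube 1) = ((2 * 1) ^+ n)%:E by exact: lebesgue_cube.
have bQ : bounded_borel (cube 1 : set 'rV[R]_n).
  split; last exact: measurable_cube.
  exists 1; split; first exact: num_real.
  by move=> y y1 x /(cube_norm _ ler01) /le_trans; apply; exact: ltW.
have Q0 : (0 < lambda (cube 1))%E by rewrite lQ lte_fin exprn_gt0// mulr1.
have := minimizer_le bQ Q0; rewrite (ratioE lM) (ratioE lQ) => le.
have := interaction_ge0 perimeter_kernel_ge0 M (~` M).
case: (interaction k M (~` M)) le => [x|le _|//]; first by rewrite ltry.
have : (+oo < +oo :> \bar R)%E; last by rewrite ltxx.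
rewrite gt0_mulye ?lte_fin ?powR_gt0// in le.
apply: le_lt_trans le _; apply: lte_mul_pinfty.
- exact: (interaction_ge0 perimeter_kernel_ge0).
- by rewrite ge0_fin_numE//; exact: (interaction_ge0 perimeter_kernel_ge0).
- exact: ltry.
Qed.

Lemma minimizer_interaction_le E : bounded_borel E -> lambda E = lambda M ->
  (interaction k M (~` M) <= interaction k E (~` E))%E.
Proof.
move=> bE lE; have [r r0 lM] := lamM.
have E0 : (0 < lambda E)%E by rewrite lE.
have := minimizer_le bE E0; rewrite (ratioE lM) (ratioE (etrans lE lM)).
by rewrite lee_pmul2r// lte_fin powR_gt0.
Qed.

(** The polarized set is again a bounded Borel set, of the same volume as [M], so minimality forbids
    a drop of its perimeter. *)
Lemma minimizer_polarized i c :
  lambda [set x | M x /\ c < x ord0 i /\ ~ M (mirror i c x)] = 0%E \/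
  lambda [set x | M x /\ x ord0 i < c /\ ~ M (mirror i c x)] = 0%E.
Proof.
have mmM : measurable (~` (mirror i c @^-1` M)).
  by apply: measurableC; exact: measurable_signed_translation_preimage.
apply: (interaction_polarization measurable_perimeter_kernel
  perimeter_kernel_ge0 perimeter_kernel_reflection perimeter_kernel_lt mM
  minimizer_interaction_lty).
set B' := [set x | _].
have mB' : measurable B'.
  rewrite (_ : B' = M `&` [set x : 'rV[R]_n | x ord0 i < c] `&` ~` (mirror i c @^-1` M)).
    by apply: measurableI => //; apply: measurableI => //; exact: measurable_coord_lt.
  by apply/seteqP; split => x; [move=> -[? []]|move=> -[[]]].
have msB' : measurable (mirror i c @^-1` B').
  exact: measurable_signed_translation_preimage.
have B'M : B' `<=` M by move=> x [].
apply: minimizer_interaction_le.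
  split; last by apply: measurableU => //; exact: measurableD.
  have [C C0 MC] := minimizer_bounded.
  (* The mirrored coordinate is [2 * c - x_i]. *)
  exists (C + `|2 * c|); split; first exact: num_real.
  move=> y Cy x Ex; apply: le_trans (ltW Cy).
  case: Ex => [[Mx _]|[Mx _]]; first by apply: (le_trans (MC _ Mx)); rewrite lerDl.
  have C1 : 0 <= C + `|2 * c| by rewrite addr_ge0// ltW.
  apply/(cube_norm _ C1) => j.
  have := MC _ Mx => /(cube_norm _ (ltW C0)) /(_ j); rewrite mirrorE.
  have := ler_norm (2 * c); have := ler_norm (- (2 * c)); rewrite normrN.
  by case: eqP => _; lra.
(* The mirror image of [B'] misses [M] by the choice of [B'], so the removed volume is exactly
   restored. *)
rewrite measureU//; last 2 first.
- exact: measurableD.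
- by apply/seteqP; split => // x [[Mx _] [_ [_]]]; rewrite mirrorK.
have lsB' : lambda (mirror i c @^-1` B') = lambda B'.
  exact: lebesgue_rV_signed_translation.
rewrite [X in (_ + X)%E]lsB' [RHS](measureDI _ mM mB').
by rewrite setIidr.
Qed.

End minimizer.

Lemma measurable_mirror_defect (R : realType) n (M H : set 'rV[R]_n) i c :
  measurable M -> measurable H ->
  measurable [set x | M x /\ H x /\ ~ M (mirror i c x)].
Proof.
move=> mM mH.
rewrite (_ : mkset _ = M `&` H `&` ~` (mirror i c @^-1` M)).
  apply: measurableI; first exact: measurableI.
  by apply: measurableC; exact: measurable_signed_translation_preimage.
by apply/seteqP; split => x; [move=> -[? []]|move=> -[[]]].
Qed.

Theorem theorem1p1 (R : realType) (n : nat) (s : R) (K : set 'rV[R]_n) :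
  (1 <= n)%N -> 0 < s < 1 ->
  unconditional K -> strictly_convex_body K ->
  forall M : set 'rV[R]_n, isoperimetric_minimizer s K M ->
  exists (t : 'rV[R]_n) (L : set 'rV[R]_n),
    [/\ unconditional L, star_body L & equivalent_sets (translate t M) L].
Proof.
move=> _ s01 uK sK M minM.
have mM : measurable M by case: minM => -[].
have [C C0 MC] := minimizer_bounded minM.
have /choice[p pP] i := polarized_center (i := i) mM (ltW C0) MC
  (minimizer_polarized s01 uK sK minM i).
pose c : 'rV[R]_n := \row_i p i.
pose T := signed_translation (fun=> false) c.
have TE x : T x = x + c by apply/rowP => j; rewrite !mxE expr0 mul1r.
pose N := T @^-1` M.
have mN : measurable N by exact: measurable_signed_translation_preimage.
(* [T] carries the hyperplane [x_i = d] to [x_i = d + p i], so the bisecting hyperplanes of [M]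
   become the coordinate hyperplanes for [N]. *)
have Tmirror i d x : T (mirror i d x) = mirror i (d + p i) (T x).
  apply/rowP => j; rewrite mirrorE !TE !mxE -/(mirror i d x).
  by case: eqP => [->|_]; rewrite ?expr0 ?expr1/=; ring.
have Npos i d : 0 <= d -> (@lebesgue_rV R n).-negligible
    [set x | N x /\ d < x ord0 i /\ ~ N (mirror i d x)].
  move=> d0; have [Mpos _] := pP i.
  have negM : (@lebesgue_rV R n).-negligible
      [set x | M x /\ d + p i < x ord0 i /\ ~ M (mirror i (d + p i) x)].
    apply/negligibleP; last by apply: Mpos; rewrite lerDr.
    exact: (measurable_mirror_defect _ _ mM (measurable_coord_gt _ _)).
  apply: negligibleS (negligible_signed_translation (fun=> false) c negM).
  move=> x [Nx [dx Nsx]]; split => //; split; last by rewrite -/(T x) -Tmirror.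
  by rewrite -/(T x) TE !mxE ltrD2r.
have Nneg i d : d <= 0 -> (@lebesgue_rV R n).-negligible
    [set x | N x /\ x ord0 i < d /\ ~ N (mirror i d x)].
  move=> d0; have [_ Mneg] := pP i.
  have negM : (@lebesgue_rV R n).-negligible
      [set x | M x /\ x ord0 i < d + p i /\ ~ M (mirror i (d + p i) x)].
    apply/negligibleP; last by apply: Mneg; rewrite gerDr.
    exact: (measurable_mirror_defect _ _ mM (measurable_coord_lt _ _)).
  apply: negligibleS (negligible_signed_translation (fun=> false) c negM).
  move=> x [Nx [dx Nsx]]; split => //; split; last by rewrite -/(T x) -Tmirror.
  by rewrite -/(T x) TE !mxE ltrD2r.
have [Z [mZ Z0 NZ]] := ae_orthant_box mN Npos Nneg.
have D0 : 0 <= C + `|c| by rewrite addr_ge0// ltW.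
have NC x : N x -> `|x| <= C + `|c|.
  move=> Nx; rewrite -[x](addrK c) -TE; apply: (le_trans (ler_normB _ _)).
  by rewrite lerD2r; exact: MC.
have N0 : lebesgue_rV N <> 0%E.
  rewrite [X in X <> _]lebesgue_rV_signed_translation// => lM0.
  by have [_] := minM; rewrite lM0 ltxx.
have U0 : (box_hull N (C + `|c|))^° 0 by exact: box_hull_interior0 mN D0 NC mZ Z0 NZ N0.
(* [N] is the preimage of [M] under translation by [c], that is, [M] translated by [- c]; it has
   radius at most [C] plus the norm of [c]. *)
exists (- c), (box_hull N (C + `|c|)); split.
- exact: box_hull_unconditional.
- split => //.
  + exact: box_hull_bounded.
  + exact: box_hull_star_shaped.
  + apply: (@radial_continuous _ _ _ (C + `|c|)).
    * exact: open_box_hull.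
    * exact: interior_subset.
    * by move=> x; exact: box_hull_norm.
    * by move=> x y; exact: box_hull_anti.
rewrite /equivalent_sets (_ : translate _ _ = N).
  apply: negligibleU.
    exact: sub_box_hull mN D0 NC mZ Z0 NZ.
  exact: box_hull_sub.
apply/seteqP; split => [_ [x Mx <-]|x Nx]; first by rewrite /N /preimage/= TE subrK.
by exists (T x) => //; rewrite TE addrK.
Qed.
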